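(* Let $a,b\in\mathbb{R}$ with $a<b$, let $f\in C[a,b]$ and let $\alpha\in(0,1)$. For all $r\in\mathbb{R}$ and $t\in[a,b]$ define $$\phi(t,r)=c_\alpha\, e^{(1-\alpha)r}\int_a^t e^{-(t-\tau)e^r} f(\tau)\,d\tau,\qquad c_\alpha=\frac{\sin(\pi\alpha)}{\pi}.$$ Then the following hold. (i) For every $r\in\mathbb{R}$, the function $\phi(\cdot,r)$ is the unique solution on $[a,b]$ of the initial value problem $$\frac{\partial\phi(t,r)}{\partial t}=-e^r\phi(t,r)+c_\alpha e^{(1-\alpha)r}f(t),\qquad \phi(a,r)=0.$$ (ii) For every $t\in[a,b]$, $$I_a^\alpha f(t)=\int_{-\infty}^{\infty}\phi(t,r)\,dr.$$ (iii) For every $t\in[a,b]$, $\phi(t,\cdot)\in C^\infty(\mathbb{R})$. (iv) For every $t\in[a,b]$ there exists a real constant $C$ such that $$|\phi(t,r)|\le C e^{-\alpha r}\quad\text{as } r\to\infty$$ (i.e. for all sufficiently large $r$) and $$|\phi(t,r)|\le C e^{(1-\alpha)r}\quad\text{as } r\to-\infty$$ (i.e. for all sufficiently negative $r$).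
   Context: For $f\in C[a,b]$ and $\alpha\in(0,1)$, the Riemann-Liouville fractional integral of order $\alpha$ with starting point $a$ is $$I_a^\alpha f(t)=\frac{1}{\Gamma(\alpha)}\int_a^t (t-\tau)^{\alpha-1}f(\tau)\,d\tau,\qquad t\in[a,b].$$ *)

(* Defs.v *)
From mathcomp Require Import all_boot all_order all_algebra.
From mathcomp Require Import all_classical all_reals all_analysis.

Set Implicit Arguments.
Unset Strict Implicit.
Unset Printing Implicit Defensive.

Import Order.TTheory GRing.Theory Num.Theory.
Import numFieldNormedType.Exports.

Local Open Scope classical_set_scope.
Local Open Scope ring_scope.

(* Euler's integral; meaningful for [0 < x], where the integral converges. *)
Definition Gamma (R : realType) (x : R) : R :=
  \int[@lebesgue_measure R]_(s in `]0, +oo[) (s `^ (x - 1) * expR (- s)).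

(* Riemann-Liouville integral of order [alpha] with starting point [a].  The
   singular endpoint [tau = t], where [powR 0 (alpha - 1) = 0] for [alpha < 1],
   is a null set. *)
Definition RLint (R : realType) (a alpha : R) (f : R -> R) (t : R) : R :=
  (Gamma alpha)^-1 *
  \int[@lebesgue_measure R]_(tau in `[a, t]) ((t - tau) `^ (alpha - 1) * f tau).

Definition c_ (R : realType) (alpha : R) : R := sin (pi * alpha) / pi.

Definition phi (R : realType) (a alpha : R) (f : R -> R) (t r : R) : R :=
  c_ alpha * expR ((1 - alpha) * r) *
  \int[@lebesgue_measure R]_(tau in `[a, t])
    (expR (- (t - tau) * expR r) * f tau).

(* Derivative at [x] of the restriction of [g] to [A]; at an endpoint of an
   interval [A] this is the one-sided derivative. *)
Definition is_derive_within (R : realType) (A : set R) (g : R -> R) (x d : R)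
    : Prop :=
  (g s - g x) / (s - x) @[s --> within A x^'] --> d.

(* [y] solves [y' = F(t, y)] on the closed interval [a, b] with [y a = y0].
   Values of [y] outside [a, b] are irrelevant. *)
Definition solves_ivp (R : realType) (a b : R) (F : R -> R -> R) (y0 : R)
    (y : R -> R) : Prop :=
  (forall t, t \in `[a, b] -> is_derive_within `[a, b] y t (F t (y t))) /\
  y a = y0.

Definition smooth (R : realType) (g : R -> R) : Prop :=
  forall n : nat, (forall x, derivable (derive1n n g) x 1) /\ continuous (derive1n n g).

(* Main.v *)
(* Part (ii) rests on Fubini's theorem.  For s < t the substitution
   u = (t - s) e^r gives
     int_R exp((1 - alpha) r - (t - s) e^r) dr
       = (t - s)^(alpha - 1) Gamma(1 - alpha),
   so that what remains is Euler's reflection formula.  With Gamma written as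
   Gamma(x) = int_R exp(x r - e^r) dr, Tonelli's theorem turns the product
   Gamma(x) Gamma(1 - x) into int_R e^(x r) / (1 + e^r) dr, which in turn is half
   the integral over [x/2, (x + 1)/2] of
     K(b) = int_R s e^(b s) / (e^s - 1) ds.
   Herglotz' trick identifies K(b) with pi^2 / sin^2(pi b): both functions satisfy
   4 K(b) = K(b/2) + K((b + 1)/2) and their difference is bounded on ]0, 1[,
   hence zero. *)
Require Import Defs.
From mathcomp Require Import all_boot all_order all_algebra.
From mathcomp Require Import all_classical all_reals all_analysis.
From mathcomp Require Import measurable_realfun ring lra.

Set Implicit Arguments.
Unset Strict Implicit.
Unset Printing Implicit Defensive.

Import Order.TTheory GRing.Theory Num.Theory.
Import numFieldNormedType.Exports.

Local Open Scope classical_set_scope.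
Local Open Scope ring_scope.

(** * Changes of variables on half-lines and on the line *)

(** The integrals behind the reflection formula have nonnegative integrands and are kept in the
    extended reals, so Tonelli applies before anything is known to converge. Finiteness comes last:
    a product equal to the finite positive number pi / sin(pi x) leaves neither factor infinite nor
    zero. [K] arises because integrating e^(b s) in b over [x/2, (x + 1)/2] gives e^(x s/2) (e^(s/2)
    - 1) / s, which the factor s / (e^s - 1) turns into e^(x s/2) / (1 + e^(s/2)). On the
    closed-form side pi^2 / sin^2(pi b) has the antiderivative -pi cot(pi b). In the functional
    equation the weight 4 stands against only two terms, so a bound on the difference is halved at
    each use. The obstacle in (ii) is the joint integrability that Fubini asks for, since (t -
    s)^(alpha - 1) is singular at s = t. Integrating in s first avoids the singularity: the
    estimates of (iv), applied to |f|, then give exponential decay at both ends of the r-line. *)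

Section substitutions.
Context {R : realType}.
Implicit Types (G : R -> R).
Notation mu := (@lebesgue_measure R).

Let derive1_expR : expR^`()%classic = @expR R.
Proof. by apply/funext => y; rewrite derive1E derive_val. Qed.

(** The substitution holds on each compact interval [e^(-n), e^n]; monotone convergence along this
    exhaustion gives both sides, finite or not. *)
Lemma ge0_integral_expR_subst G : {in `]0, +oo[, continuous G} ->
  (forall x, 0 < x -> 0 <= G x) ->
  (\int[mu]_(x in `]0%R, +oo[) (G x)%:E =
   \int[mu]_r (G (expR r) * expR r)%:E)%E.
Proof.
move=> cG G0.
have U1 : `]0%R, +oo[%classic = \bigcup_n `[expR (- n%:R), expR n%:R]%classic :> set R.
  apply/seteqP; split => [x /=|x [n _] /=]; rewrite !in_itv/= ?andbT.
    move=> x0; exists (Num.truncn `|ln x|).+1 => //=; rewrite in_itv/=.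
    have := ltW (truncnS_gt `|ln x|); rewrite ler_norml => /andP[? ?].
    by rewrite -[x in _ <= x <= _]lnK ?posrE// !ler_expR; apply/andP; split.
  by move=> /andP[+ _]; exact/lt_le_trans/expR_gt0.
have U2 : [set: R] = \bigcup_n `[- n%:R, n%:R]%classic.
  apply/seteqP; split => // x _; exists (Num.truncn `|x|).+1 => //=.
  by rewrite in_itv/= -ler_norml; exact/ltW/truncnS_gt.
have mG : measurable_fun (`]0, +oo[ : set R) G.
  by apply: open_continuous_measurable_fun => // x; rewrite inE; exact: cG.
have cGe : continuous (fun r => G (expR r) * expR r).
  move=> r; apply: continuousM; last exact: continuous_expR.
  apply: continuous_comp; first exact: continuous_expR.
  by apply: cG; rewrite in_itv/= expR_gt0.
have h n : (\int[mu]_(x in `[expR (- n%:R), expR n%:R]) (G x)%:E =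
    \int[mu]_(r in `[(- n%:R)%R, n%:R]) (G (expR r) * expR r)%:E)%E.
  rewrite integration_by_substitution_increasing ?derive1_expR//.
  - by rewrite (@le_trans _ _ 0) ?oppr_le0.
  - by move=> x y _ _; rewrite ltr_expR.
  - by move=> x _; exact: continuous_expR.
  - apply/cvg_ex; exists (expR (- n%:R)); apply: cvg_at_right_filter.
    exact: continuous_expR.
  - apply/cvg_ex; exists (expR n%:R); apply: cvg_at_left_filter.
    exact: continuous_expR.
  - split => //.
    + by apply: cvg_at_right_filter; exact: continuous_expR.
    + by apply: cvg_at_left_filter; exact: continuous_expR.
  - apply: continuous_in_subspaceT => x; rewrite inE/= in_itv/= => /andP[+ _].
    by move/(lt_le_trans (expR_gt0 _)) => x0; apply: cG; rewrite in_itv/= x0.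
have c1 : (\int[mu]_(x in `[expR (- n%:R), expR n%:R]) (G x)%:E @[n --> \oo] -->
    \int[mu]_(x in `]0%R, +oo[) (G x)%:E)%E.
  rewrite U1; apply: ge0_nondecreasing_set_cvg_integral => //.
  - apply/nondecreasing_seqP => n; apply/subsetPset/subset_itvScc;
      by rewrite bnd_simp ler_expR ?lerN2 ler_nat.
  - move=> n; apply/measurable_EFinP; apply: measurable_funS mG => //.
    by move=> x nx; rewrite U1; exists n.
  - by move=> n x; rewrite /= in_itv/= lee_fin => /andP[+ _];
      move/(lt_le_trans (expR_gt0 _)); exact: G0.
have c2 : (\int[mu]_(r in `[(- n%:R)%R, n%:R]) (G (expR r) * expR r)%:E @[n --> \oo] -->
    \int[mu]_r (G (expR r) * expR r)%:E)%E.
  rewrite U2; apply: ge0_nondecreasing_set_cvg_integral => //.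
  - apply/nondecreasing_seqP => n; apply/subsetPset/subset_itvScc;
      by rewrite bnd_simp ?lerN2 ler_nat.
  - move=> n; apply/measurable_EFinP; apply: measurable_funTS.
    exact: continuous_measurable_fun.
  - by move=> n x _; rewrite lee_fin mulr_ge0 ?expR_ge0// G0 ?expR_gt0.
rewrite (eq_cvg _ _ h) in c1.
exact: cvg_unique c1 c2.
Qed.

Lemma ge0_integralT_affine G (c d : R) : 0 < c -> continuous G ->
  (forall x, 0 <= G x) ->
  (\int[mu]_x (G x)%:E = c%:E * \int[mu]_x (G (c * x + d))%:E)%E.
Proof.
move=> c0 cG G0.
have dF x : is_derive x (1:R) (fun x : R => c * x + d) c.
  apply: (is_derive_eq (is_deriveD (is_deriveM (is_derive_cst c x 1)
    (is_derive_id x (1:R))) (is_derive_cst d x 1))).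
  by rewrite scaler0 !addr0 /GRing.scale/= mulr1.
have dFE : (fun x : R => c * x + d)^`()%classic = cst c.
  by apply/funext => x; rewrite derive1E derive_val.
have cF : continuous (fun x : R => c * x + d).
  by move=> x; apply: differentiable_continuous; apply/derivable1_diffP.
rewrite (@increasing_ge0_integration_by_substitutionT _ (fun x => c * x + d))//.
- rewrite -ge0_integralZl//=.
  + by apply: eq_integral => x _; rewrite dFE /= EFinM muleC.
  + apply/measurable_EFinP; apply: continuous_measurable_fun => x.
    by apply: continuous_comp; [exact: cF|exact: cG].
  + by move=> x _; rewrite lee_fin.
  + by rewrite lee_fin ltW.
- by move=> x y xy; rewrite ltrD2r ltr_pM2l.
- by rewrite dFE => x; exact: cvg_cst.
- by rewrite dFE; exact: is_cvg_cst.
- by rewrite dFE; exact: is_cvg_cst.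
- apply/cvgrNyPle => A; near=> x.
  by rewrite -lerBrDr mulrC -ler_pdivlMr//; near: x; exact: nbhs_ninfty_le.
- apply/cvgryPge => A; near=> x.
  by rewrite -lerBlDr mulrC -ler_pdivrMr//; near: x; exact: nbhs_pinfty_ge.
Unshelve. all: by end_near. Qed.

Lemma ge0_integralT_halves G : measurable_fun setT G -> (forall x, 0 <= G x) ->
  (\int[mu]_x (G x)%:E = \int[mu]_(x in `[0%R, +oo[) (G x)%:E +
     \int[mu]_(x in `[0%R, +oo[) (G (- x))%:E)%E.
Proof.
move=> mG G0.
rewrite -(setUv `[0%R, +oo[%classic) ge0_integral_setU//=; last 4 first.
  exact: measurableC.
  by rewrite setUv; exact/measurable_EFinP.
  by move=> x _; rewrite lee_fin.
  exact/disj_setPCl.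
congr adde; rewrite setCitvr integral_itv_bndo_bndc; last first.
  by apply/measurable_EFinP; exact: measurable_funTS.
rewrite (@ge0_integration_by_substitution0 _ (fun x => (G (- x))%:E))//.
- by apply: eq_integral => x _; rewrite opprK.
- by apply/measurable_EFinP; apply: measurableT_comp => //; exact: measurable_oppr.
- by move=> r; rewrite lee_fin.
Qed.

End substitutions.

(** * Exponential integrals over the half-line *)

Section exponential_integrals.
Context {R : realType}.
Notation mu := (@lebesgue_measure R).

Lemma cvgy_expRNM (c : R) : 0 < c -> expR (- (c * x)) @[x --> +oo] --> (0 : R).
Proof.
move=> c0; apply: (@cvg_comp _ _ _ (fun x => c * x) (fun x => expR (- x)) _
  (pinfty_nbhs R)); last exact: cvgr_expR.
exact: gt0_cvgMry.
Qed.

Lemma is_derive_expRM (c x : R) :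
  is_derive x 1 (fun y => expR (c * y)) (c * expR (c * x)).
Proof.
have := @is_derive1_comp _ expR (cst c * id) x _ _ (is_derive_expR _)
  (is_deriveM (is_derive_cst c x 1) (is_derive_id x (1:R))).
by move/is_derive_eq; apply; rewrite scaler0 addr0 /GRing.scale/= mulr1 mulrC.
Qed.

Lemma continuous_expRM (c : R) : continuous (fun y => expR (c * y)).
Proof.
by move=> x; apply: differentiable_continuous; apply/derivable1_diffP;
  have [] := is_derive_expRM c x.
Qed.

Lemma continuous_expRNM (c : R) : continuous (fun y => expR (- (c * y))).
Proof.
move=> x; rewrite /continuous_at -mulNr.
by under eq_fun do rewrite -mulNr; exact: continuous_expRM.
Qed.

Lemma integral0y_expRN (c : R) : 0 < c ->
  (\int[mu]_(x in `[0%R, +oo[) (expR (- (c * x)))%:E = (c^-1)%:E)%E.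
Proof.
move=> c0; have cn0 : c != 0 by rewrite gt_eqF.
have dF x : is_derive x (1:R) (fun y => - c^-1 * expR (- (c * y))) (expR (- (c * x))).
  under [X in is_derive _ _ X _]eq_fun do rewrite -mulNr.
  apply: (is_derive_eq (is_deriveM (is_derive_cst (- c^-1) x 1)
    (is_derive_expRM (- c) x))).
  by rewrite scaler0 addr0 /GRing.scale/= mulrA mulrNN mulVf// mul1r mulNr.
rewrite (@ge0_continuous_FTC2y _ _ (fun x => - c^-1 * expR (- (c * x))) 0 0)//.
- by rewrite mulr0 oppr0 expR0 mulr1 EFinN oppeK add0e.
- apply: continuous_subspaceT => x.
  exact: continuous_expRNM.
- rewrite -(mulr0 (- c^-1)); apply: cvgM; first exact: cvg_cst.
  exact: cvgy_expRNM.
- apply: cvg_at_right_filter.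
  by have [/derivable1_diffP/differentiable_continuous] := dF 0.
- by move=> x _; rewrite derive1E derive_val.
Qed.

Lemma integral0y_XexpRN (c : R) : 0 < c ->
  (\int[mu]_(x in `[0%R, +oo[) (x * expR (- (c * x)))%:E = (c ^- 2)%:E)%E.
Proof.
move=> c0; have cn0 : c != 0 by rewrite gt_eqF.
(* The antiderivative obtained by parts; its value at 0 is -1/c^2. *)
pose F (y : R) := - (c^-1 * y + c ^- 2) * expR (- (c * y)).
have dF x : is_derive x (1:R) F (x * expR (- (c * x))).
  rewrite /F; under [X in is_derive _ _ X _]eq_fun do rewrite -[in expR _]mulNr.
  apply: (is_derive_eq (is_deriveM (is_deriveN (is_deriveD
    (is_deriveM (is_derive_cst (c^-1) x 1) (is_derive_id x (1:R)))
    (is_derive_cst (c ^- 2) x 1)))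
    (is_derive_expRM (- c) x))).
  by rewrite !fctE scaler0 !addr0 /GRing.scale/= !mulNr; field.
have cy : F x @[x --> +oo] --> (0 : R).
  (* Half of the exponential absorbs the linear factor: e^u >= 1 + u at u = c x / 2 gives x e^(-c
     x/2) <= 2/c. The other half still tends to 0. *)
  have h : (fun x => - (c^-1 * (2 / c) + c ^- 2) * expR (- (c / 2 * x)))
      @ +oo --> (0 : R).
    rewrite -[X in _ --> X](mulr0 (- (c^-1 * (2 / c) + c ^- 2))).
    apply: cvgM; first exact: cvg_cst.
    by apply: cvgy_expRNM; rewrite divr_gt0.
  apply: (squeeze_cvgr _ h (cvg_cst 0)); near=> x.
  have x0 : 0 < x by near: x; exact: nbhs_pinfty_gt.
  have e1 : expR (- (c * x)) = expR (- (c / 2 * x)) * expR (- (c / 2 * x)).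
    by rewrite -expRD; congr expR; field.
  have e2 : x * expR (- (c / 2 * x)) <= 2 / c.
    rewrite expRN ler_pdivrMr ?expR_gt0//.
    have := expR_ge1Dx (c / 2 * x).
    rewrite -(ler_pM2l (divr_gt0 (@ltr0Sn R 1) c0 : 0 < 2 / c)); apply: le_trans.
    have -> : 2 / c * (1 + c / 2 * x) = 2 / c + x by field.
    by rewrite lerDr divr_ge0// ltW.
  have e3 : expR (- (c / 2 * x)) <= 1.
    by rewrite -expR0 ler_expR oppr_le0 mulr_ge0 ?divr_ge0// ltW.
  have := expR_gt0 (- (c / 2 * x)).
  move: e1 e2 e3; set e := expR (- (c / 2 * x)) => e1 e2 e3 e0.
  have ci : 0 < c^-1 by rewrite invr_gt0.
  have ci2 : 0 < c ^- 2 by rewrite invr_gt0 exprn_gt0.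
  apply/andP; split; rewrite /F; last first.
    by rewrite mulNr oppr_le0 mulr_ge0 ?expR_ge0// addr_ge0 ?mulr_ge0// ltW.
  rewrite !mulNr lerN2 e1 [leLHS]mulrA ler_pM2r//.
  rewrite mulrDl -mulrA; apply: lerD; first by rewrite ler_pM2l.
  by rewrite -[leRHS]mulr1 ler_pM2l.
rewrite (@ge0_continuous_FTC2y _ _ F 0 0)//.
- by rewrite /F !mulr0 oppr0 expR0 mulr1 EFinN oppeK !add0r.
- by move=> x x0; rewrite mulr_ge0// expR_ge0.
- apply: continuous_subspaceT => x.
  apply: (@continuousM _ _ id (fun x => expR (- (c * x)))); first exact: cvg_id.
  exact: continuous_expRNM.
- apply: cvg_at_right_filter.
  by have [/derivable1_diffP/differentiable_continuous] := dF 0.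
- by move=> x _; rewrite derive1E derive_val.
Unshelve. all: by end_near. Qed.

End exponential_integrals.

(** * The integral K(b) and Herglotz' trick *)

Section bernoulli_kernel.
Context {R : realType}.
Notation mu := (@lebesgue_measure R).

(** The generating function of the Bernoulli numbers, with its removable singularity at 0 filled
    in. *)
Definition bernoulli_kernel (s : R) : R := if s == 0 then 1 else s / (expR s - 1).

Lemma bernoulli_kernel0 : bernoulli_kernel 0 = 1.
Proof. by rewrite /bernoulli_kernel eqxx. Qed.

Lemma expRB1_neq0 (s : R) : s != 0 -> expR s - 1 != 0.
Proof. by move=> s0; rewrite subr_eq0 -expR0 (inj_eq (@expR_inj R)). Qed.

Lemma bernoulli_kernel_gt0 s : 0 < bernoulli_kernel s.
Proof.
rewrite /bernoulli_kernel; case: eqVneq => // s0.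
have [sp|sn|/esym/eqP] := ltgtP 0 s; last by rewrite (negbTE s0).
- by rewrite divr_gt0// subr_gt0 -[ltLHS]expR0 ltr_expR.
- by rewrite -mulrNN -invrN mulr_gt0 ?invr_gt0 ?oppr_gt0// subr_lt0 -[ltRHS]expR0
    ltr_expR.
Qed.

(** Folds the negative half-line onto the positive one; this is the source of the symmetry between b
    and 1 - b. *)
Lemma bernoulli_kernelN s : bernoulli_kernel (- s) = bernoulli_kernel s * expR s.
Proof.
rewrite /bernoulli_kernel oppr_eq0; case: eqVneq => [->|s0]; first by rewrite expR0 mulr1.
have ? := expRB1_neq0 s0; have ? : 1 - expR s != 0 by rewrite -opprB oppr_eq0.
have ? : expR s != 0 by rewrite gt_eqF ?expR_gt0.
rewrite expRN; field; apply/and3P; split => //.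
by rewrite mulN1r.
Qed.

(** Splits off the term s, which carries the whole singularity of the Laplace integral; the
    remaining kernel decays exponentially on the positive half-line. *)
Lemma bernoulli_kernel_expR s : bernoulli_kernel s * expR s = s + bernoulli_kernel s.
Proof.
rewrite /bernoulli_kernel; case: eqVneq => [->|s0]; first by rewrite expR0 mulr1 add0r.
by have ? := expRB1_neq0 s0; field.
Qed.

(** From e^s - 1 = (e^(s/2) - 1)(e^(s/2) + 1). Integrated against an exponential, this becomes the
    functional equation of K. *)
Lemma bernoulli_kernel_half s :
  bernoulli_kernel s * (1 + expR (s / 2)) = 2 * bernoulli_kernel (s / 2).
Proof.
rewrite /bernoulli_kernel mulf_eq0 invr_eq0 pnatr_eq0 orbF.
case: eqVneq => [->|s0]; first by rewrite mul0r expR0 mul1r mulr1.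
have sh : s / 2 != 0 by rewrite mulf_neq0// invr_eq0 pnatr_eq0.
have := expRB1_neq0 s0; have := expRB1_neq0 sh.
have -> : expR s = expR (s / 2) * expR (s / 2) by rewrite -expRD -splitr.
set e := expR _ => e1.
rewrite (_ : e * e - 1 = (e - 1) * (e + 1)); last by ring.
rewrite mulf_eq0 negb_or => /andP[_ e2].
by field; apply/andP; split.
Qed.

Lemma bernoulli_kernel_le s : 0 <= s -> bernoulli_kernel s <= 2 * expR (- (2^-1 * s)).
Proof.
rewrite /bernoulli_kernel le_eqVlt => /predU1P[<-|s0].
  by rewrite eqxx mulr0 oppr0 expR0 mulr1 ler1n.
rewrite gt_eqF// ler_pdivrMr; last by rewrite subr_gt0 -[ltLHS]expR0 ltr_expR.
have -> : expR s = expR (s / 2) * expR (s / 2) by rewrite -expRD -splitr.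
rewrite (mulrC 2^-1) expRN.
have := expR_ge1Dx (s / 2); set e := expR _ => h.
have e0 : 0 < e by exact: expR_gt0.
rewrite -mulrA mulrCA ler_pdivlMl//.
nra.
Qed.

Lemma continuous_bernoulli_kernel : continuous bernoulli_kernel.
Proof.
move=> x; have [->|x0] := eqVneq x 0; last first.
  have xn0 : nbhs x [set s : R | s != 0].
    by apply: open_nbhs_nbhs; split; [exact: open_neq|].
  have : (fun s => s / (expR s - 1)) @ x --> bernoulli_kernel x.
    rewrite /bernoulli_kernel (negbTE x0); apply: cvgM; first exact: cvg_id.
    apply: cvgV; first exact: expRB1_neq0.
    by apply: cvgB; [exact: continuous_expR|exact: cvg_cst].
  apply: cvg_trans; apply: near_eq_cvg; near=> s.
  rewrite /bernoulli_kernel ifF//; apply/negbTE; near: s.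
  exact: xn0.
(* Near 0 the kernel is the reciprocal of the difference quotient of [expR] at 0, whose limit is
   1. *)
apply/continuous_withinNx; rewrite bernoulli_kernel0 -[X in _ --> X]invr1.
have h : (fun s : R => s^-1 * (expR s - 1)) @ 0^' --> (1 : R).
  have [d e] := is_derive_expR (0:R); rewrite expR0 in e.
  have -> : (fun s : R => s^-1 * (expR s - 1)) =
      (fun h : R => h^-1 *: ((expR \o shift 0) (h *: (1 : R)) - expR 0)).
    by apply/funext => s; rewrite /= /GRing.scale/= addr0 mulr1 expR0.
  by rewrite -[X in _ --> X]e; exact: d.
have hV : (fun s : R => (s^-1 * (expR s - 1))^-1) @ 0^' --> (1^-1 : R).
  exact: cvgV (@oner_neq0 R) h.
apply: cvg_trans hV.
apply: near_eq_cvg; near=> s.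
have s0 : s != 0 by near: s; exact: nbhs_dnbhs_neq.
by rewrite /bernoulli_kernel (negbTE s0) invfM invrK mulrC.
Unshelve. all: by end_near. Qed.

End bernoulli_kernel.

Section bern_laplace_integral.
Context {R : realType}.
Notation mu := (@lebesgue_measure R).

Definition bern_laplace_half (c : R) : \bar R :=
  (\int[mu]_(s in `[0%R, +oo[) (bernoulli_kernel s * expR (c * s))%:E)%E.

(** The K(b) of the overview, extended-real valued so that its functional equation can be stated for
    every b. *)
Definition bern_laplace (b : R) : \bar R :=
  (\int[mu]_s (bernoulli_kernel s * expR (b * s))%:E)%E.

Let cG (b : R) : continuous (fun s => bernoulli_kernel s * expR (b * s)).
Proof.
move=> s; apply: continuousM; last exact: continuous_expRM.
exact: continuous_bernoulli_kernel.
Qed.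

Let mG (b : R) : measurable_fun setT (fun s => bernoulli_kernel s * expR (b * s)).
Proof. by apply: continuous_measurable_fun; exact: cG. Qed.

Let G0 (b s : R) : 0 <= bernoulli_kernel s * expR (b * s).
Proof. by rewrite mulr_ge0 ?expR_ge0// ltW// bernoulli_kernel_gt0. Qed.

Lemma bern_laplace_halves b :
  bern_laplace b = (bern_laplace_half b + bern_laplace_half (1 - b))%E.
Proof.
rewrite /bern_laplace ge0_integralT_halves//; congr (_ + _)%E.
apply: eq_integral => s _; rewrite bernoulli_kernelN -mulrA -expRD.
congr ((_ * expR _)%:E).
by rewrite mulrN mulrBl mul1r.
Qed.

(** The integrand equals (s + k(s)) e^(-(1 - c) s), with k the kernel. The term s integrates to the
    double pole (1 - c)^(-2); the rest lies between 0 and 2 e^(-s/2), whose integral is 4. *)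
Lemma bern_laplace_half_bounds c : c < 1 ->
  ((((1 - c) ^- 2)%:E <= bern_laplace_half c) /\
   (bern_laplace_half c <= ((1 - c) ^- 2 + 4)%:E))%E.
Proof.
move=> c1; have c0 : 0 < 1 - c by rewrite subr_gt0.
have E s : bernoulli_kernel s * expR (c * s) =
    s * expR (- ((1 - c) * s)) + bernoulli_kernel s * expR (- ((1 - c) * s)).
  rewrite -mulrDl -bernoulli_kernel_expR -mulrA -expRD; congr (_ * expR _); ring.
have m1 : measurable_fun setT (fun s : R => s * expR (- ((1 - c) * s))).
  apply: measurable_funM => //; apply: continuous_measurable_fun.
  exact: continuous_expRNM.
have m2 : measurable_fun setT (fun s : R => 2 * expR (- (2^-1 * s))).
  apply: measurable_funM => //; apply: continuous_measurable_fun.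
  exact: continuous_expRNM.
split.
  rewrite -integral0y_XexpRN// /bern_laplace_half; apply: ge0_le_integral => //.
  - by move=> x; rewrite /= in_itv/= andbT => x0; rewrite lee_fin mulr_ge0// expR_ge0.
  - exact/measurable_EFinP/measurable_funTS.
  - by apply/measurable_EFinP/measurable_funTS; exact: mG.
  - move=> x _; rewrite lee_fin E lerDl mulr_ge0 ?expR_ge0//.
    exact/ltW/bernoulli_kernel_gt0.
have -> : (((1 - c) ^- 2 + 4)%:E = \int[mu]_(s in `[0%R, +oo[)
    ((s * expR (- ((1 - c) * s)))%:E + (2 * expR (- (2^-1 * s)))%:E))%E.
  rewrite ge0_integralD//.
  - rewrite integral0y_XexpRN//.
    under [in X in (_ + X)%E]eq_integral do rewrite EFinM.
    rewrite ge0_integralZl//.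
    + by rewrite integral0y_expRN// invrK -EFinM -EFinD; congr (_ + _)%:E; ring.
    + apply/measurable_EFinP; apply: measurable_funTS.
      by apply: continuous_measurable_fun; exact: continuous_expRNM.
  - by move=> x; rewrite /= in_itv/= andbT => x0; rewrite lee_fin mulr_ge0// expR_ge0.
  - exact/measurable_EFinP/measurable_funTS.
  - exact/measurable_EFinP/measurable_funTS.
apply: ge0_le_integral => //.
- by move=> x _; rewrite lee_fin.
- by apply/measurable_EFinP/measurable_funTS; exact: mG.
- by apply: emeasurable_funD; exact/measurable_EFinP/measurable_funTS.
- move=> x; rewrite /= in_itv/= andbT => x0; rewrite lee_fin E lerD2l.
  apply: (le_trans _ (bernoulli_kernel_le x0)).
  rewrite -[leRHS]mulr1 ler_pM2l ?bernoulli_kernel_gt0//.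
  by rewrite -[leRHS]expR0 ler_expR oppr_le0 mulr_ge0// ?(ltW c0).
Qed.

(** Replacing s by s/2 in K(b) costs a factor 1/2, so 4 K(b) is the integral of 2 k(s/2) e^(b s/2),
    that is of k(s) (1 + e^(s/2)) e^(b s/2). The two summands have exponents b/2 and (b + 1)/2. *)
Lemma bern_laplace_herglotz b :
  (bern_laplace (b / 2) + bern_laplace ((b + 1) / 2) =
   4%:E * bern_laplace b)%E.
Proof.
rewrite /bern_laplace -ge0_integralD//; last 4 first.
- by move=> x _; rewrite lee_fin.
- by apply/measurable_EFinP; exact: mG.
- by move=> x _; rewrite lee_fin.
- by apply/measurable_EFinP; exact: mG.
rewrite (@ge0_integralT_affine _ (fun s => bernoulli_kernel s * expR (b * s)) 2^-1 0)//.
rewrite muleA -EFinM -ge0_integralZl//; last 2 first.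
- apply/measurable_EFinP; apply: continuous_measurable_fun => s.
  have h : {for s, continuous (fun s : R => 2^-1 * s + 0)}.
    by apply: cvgD; [exact: mulrl_continuous|exact: cvg_cst].
  have h2 := continuous_comp h (cG (b := b) (x := _)).
  exact: h2.
- by move=> x _; rewrite lee_fin.
apply: eq_integral => s _; rewrite -EFinD -EFinM addr0 (mulrC 2^-1 s).
congr EFin.
have -> : 4 * 2^-1 * (bernoulli_kernel (s / 2) * expR (b * (s / 2))) =
   2 * bernoulli_kernel (s / 2) * expR (b * (s / 2)) by field.
rewrite -bernoulli_kernel_half mulrDr mulr1 mulrDl -[X in _ = _ + X]mulrA -expRD.
by congr (_ * expR _ + _ * expR _); field.
Qed.

End bern_laplace_integral.

(** * Elementary bounds on the sine *)

Section sine_bounds.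
Context {R : realType}.

Lemma sin_le_id (x : R) : 0 < x -> sin x <= x.
Proof.
move=> x0.
have [|c _] := @MVT R sin cos 0 x x0 (fun y _ => is_derive_sin y).
  exact/continuous_subspaceT/continuous_sin.
rewrite sin0 !subr0 => ->; rewrite -[leRHS]mul1r ler_wpM2r ?cos_le1// ltW//.
Qed.

(** The difference sin y - y cos y vanishes at 0 and has derivative y sin y, nonnegative up to
    pi. *)
Lemma mulr_cos_le_sin (x : R) : 0 < x <= pi -> x * cos x <= sin x.
Proof.
move=> /andP[x0 xpi].
have d y : is_derive y (1:R) (fun y : R => sin y - y * cos y) (y * sin y).
  apply: (is_derive_eq (is_deriveB (is_derive_sin y)
    (is_deriveM (is_derive_id y (1:R)) (is_derive_cos y)))).
  by rewrite /GRing.scale/=; ring.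
have [|c] := @MVT R _ _ 0 x x0 (fun y _ => d y).
  apply: continuous_subspaceT => y; apply: differentiable_continuous.
  by apply/derivable1_diffP; have [] := d y.
rewrite in_itv/= => /andP[c0 cx]; rewrite sin0 mul0r !subr0 => h.
rewrite -subr_ge0 h mulr_ge0 ?(ltW x0)// mulr_ge0 ?(ltW c0)//.
by rewrite sin_ge0_pi// ltW//= ltW// (lt_le_trans cx).
Qed.

(** Since sin^(-2) = cot^2 + 1 and 0 <= cot x <= 1/x. This shows that pi^2 / sin^2(pi b) has at 0
    the same double pole b^(-2) as K(b), up to a bounded error. *)
Lemma inv_sin2_bounds (x : R) : 0 < x <= pi / 2 ->
  x ^- 2 <= (sin x) ^- 2 <= x ^- 2 + 1.
Proof.
move=> /andP[x0 xpi].
have xpi1 : x < pi.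
  by rewrite (le_lt_trans xpi)// ltr_pdivrMr// ltr_pMr ?pi_gt0// ltr1n.
have s0 : 0 < sin x by apply: sin_gt0_pi; rewrite x0.
have c0 : 0 <= cos x.
  by apply: cos_ge0_pihalf; rewrite xpi andbT (le_trans _ (ltW x0))//
    oppr_le0 divr_ge0// pi_ge0.
apply/andP; split.
  by rewrite lef_pV2 ?posrE ?exprn_gt0// ler_pXn2r ?nnegrE ?(ltW s0)
    ?(ltW x0)// sin_le_id.
have -> : (sin x) ^- 2 = (cos x / sin x) ^+ 2 + 1.
  rewrite expr_div_n cos2sin2 mulrBl mul1r mulfV ?expf_neq0 ?gt_eqF//.
  by rewrite subrK.
rewrite lerD2r -exprVn ler_pXn2r ?nnegrE ?invr_ge0 ?divr_ge0 ?(ltW x0) ?(ltW s0)//.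
rewrite ler_pdivrMr// ler_pdivlMl//.
by apply: mulr_cos_le_sin; rewrite x0 ltW.
Qed.

Lemma sin_piM_gt0 (b : R) : 0 < b < 1 -> 0 < sin (pi * b).
Proof.
move=> /andP[b0 b1]; apply: sin_gt0_pi.
by rewrite mulr_gt0 ?pi_gt0//= -[ltRHS]mulr1 ltr_pM2l ?pi_gt0.
Qed.

End sine_bounds.

(** * The closed form of K(b) on ]0, 1[ *)

Section bern_laplace_closed_form.
Context {R : realType}.
Notation mu := (@lebesgue_measure R).

(** A bound M on |D| improves to M/2, because |D b| is at most a quarter of the sum of two values
    bounded by M. Both arguments b/2 and (b + 1)/2 stay in ]0, 1[, so this iterates to 2^n |D b| <=
    M for all n. *)
Lemma averaging_contraction (D : R -> R) (M : R) :
  (forall b, 0 < b < 1 -> `|D b| <= M) ->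
  (forall b, 0 < b < 1 -> 4 * D b = D (b / 2) + D ((b + 1) / 2)) ->
  forall b, 0 < b < 1 -> D b = 0.
Proof.
move=> DM DE.
have h n : forall b, 0 < b < 1 -> 2 ^+ n * `|D b| <= M.
  elim: n => [|n ih] b b01; first by rewrite expr0 mul1r; exact: DM.
  have /andP[b0 b1] := b01.
  have h1 := ih (b / 2) ltac:(lra); have h2 := ih ((b + 1) / 2) ltac:(lra).
  have p2 : 0 < (2 : R) ^+ n by rewrite exprn_gt0.
  have : 2 ^+ n * `|4 * D b| <= M + M.
    rewrite DE// (le_trans _ (lerD h1 h2))// -mulrDr ler_pM2l//.
    exact: ler_normD.
  by rewrite normrM (ger0_norm (_ : 0 <= 4))// exprS; nra.
move=> b b01; apply/eqP/negPn/negP; rewrite -normr_gt0 => D0.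
have := truncnS_gt (M / `|D b|); set n := Num.truncn _ => hn.
have := h n.+1 b b01; apply/negP; rewrite -ltNge -ltr_pdivrMr//.
apply: (lt_trans hn); rewrite -natrX ltr_nat.
exact: ltn_expl.
Qed.

Let csc2 (b : R) := pi ^+ 2 / sin (pi * b) ^+ 2.

Let csc2_sym b : csc2 (1 - b) = csc2 b.
Proof. by rewrite /csc2 mulrBr mulr1 sinB sinpi cospi; congr (_ / _); ring. Qed.

(** With s and c the sine and cosine of pi b/2, the second argument is shifted by pi/2 and turns s
    into c; then 1/s^2 + 1/c^2 = 1/(s c)^2 and sin(pi b) = 2 s c. *)
Let csc2_herglotz (b : R) : 0 < b < 1 ->
  csc2 (b / 2) + csc2 ((b + 1) / 2) = 4 * csc2 b.
Proof.
move=> b01; rewrite /csc2.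
have -> : pi * ((b + 1) / 2) = pi * (b / 2) + pi / 2 :> R by field.
have := sin_piM_gt0 b01.
have -> : pi * b = (pi * (b / 2)) *+ 2 by rewrite mulr2n; field.
rewrite sinDpihalf sin_mulr2n; have := cos2Dsin2 (pi * (b / 2)).
set s := sin _; set c := cos _ => cs sc0.
have s0 : s != 0 by apply/eqP => s0; move: sc0; rewrite s0 mulr0 mul0rn ltxx.
have c0 : c != 0 by apply/eqP => c0; move: sc0; rewrite c0 mul0r mul0rn ltxx.
have -> : pi ^+ 2 / s ^+ 2 + pi ^+ 2 / c ^+ 2 =
  pi ^+ 2 * (c ^+ 2 + s ^+ 2) / (s ^+ 2 * c ^+ 2) by field; rewrite c0 s0.
by rewrite cs -mulr_natr; field; rewrite c0 s0.
Qed.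

(** The two half-line integrals carry the poles at 1 and at 0, each with an error of at most 4. *)
Let bern_laplace_fin (b : R) : 0 < b < 1 ->
  bern_laplace b = (fine (bern_laplace b))%:E /\
  b ^- 2 + (1 - b) ^- 2 <= fine (bern_laplace b) <= b ^- 2 + (1 - b) ^- 2 + 8.
Proof.
move=> /andP[b0 b1].
have [l1 u1] := bern_laplace_half_bounds b1.
have [] := @bern_laplace_half_bounds R (1 - b) ltac:(lra).
rewrite (_ : 1 - (1 - b) = b); last by ring.
rewrite bern_laplace_halves; move: l1 u1.
case: (bern_laplace_half b) => [x| |]; rewrite ?lee_fin ?leye_eq ?leeNy_eq// => ? ?.
case: (bern_laplace_half (1 - b)) => [y| |]; rewrite ?lee_fin ?leye_eq ?leeNy_eq// => ? ?.
by split => //=; lra.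
Qed.

Lemma bern_laplaceE (b : R) : 0 < b < 1 ->
  bern_laplace b = (pi ^+ 2 / sin (pi * b) ^+ 2)%:E.
Proof.
move=> b01; rewrite (bern_laplace_fin b01).1; congr EFin.
apply/eqP; rewrite -subr_eq0; apply/eqP.
pose D (b : R) := fine (bern_laplace b) - csc2 b.
(* For b <= 1/2 the poles b^(-2) cancel. What remains of K lies between 0 and 4 + 8, as (1 - b)^(-2)
   <= 4; what remains of pi^2 / sin^2 lies between 0 and pi^2. *)
apply: (@averaging_contraction D (12 + pi ^+ 2)) b01 => {}b /[dup] b01 /andP[b0 b1].
  (* Both functions are invariant under b -> 1 - b, so only the pole at 0 has to be compared. *)
  wlog bh : b b01 b0 b1 / b <= 2^-1.
    move=> H; have [|bh] := leP b 2^-1; first exact: H.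
    have := H (1 - b) ltac:(lra) ltac:(lra) ltac:(lra) ltac:(lra).
    rewrite /D csc2_sym !bern_laplace_halves addeC.
    by rewrite (_ : 1 - (1 - b) = b); last by ring.
  have [_ /andP[l1 u1]] := bern_laplace_fin b01.
  have /andP[] := @inv_sin2_bounds R (pi * b) ltac:(apply/andP; split;
    [by rewrite mulr_gt0// pi_gt0|by rewrite ler_pM2l ?pi_gt0]).
  have p2 : 0 < (pi : R) ^+ 2 by rewrite exprn_gt0// pi_gt0.
  rewrite -(ler_pM2l p2) => l2; rewrite -(ler_pM2l p2) mulrDr mulr1; move: l2.
  have -> : pi ^+ 2 * (pi * b) ^- 2 = b ^- 2.
    have H (p : R) : p != 0 -> p ^+ 2 * (p * b) ^- 2 = b ^- 2.
      by move=> p0; field; rewrite p0 gt_eqF.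
    by rewrite H// gt_eqF// pi_gt0.
  rewrite -/(csc2 b) => l2 u2.
  have q0 : 0 <= (1 - b) ^- 2 by rewrite invr_ge0 sqr_ge0.
  have q4 : (1 - b) ^- 2 <= 4.
    rewrite -[leRHS]invrK lef_pV2 ?posrE ?invr_gt0 ?exprn_gt0 ?subr_gt0//.
    by rewrite -(ler_pM2r (_ : 0 < 4))// mulVf//; nra.
  rewrite ler_norml /D; apply/andP; split; lra.
have := bern_laplace_herglotz b.
have /andP[_ _] := b01.
rewrite (bern_laplace_fin b01).1.
rewrite (bern_laplace_fin (_ : 0 < b / 2 < 1)).1; last lra.
rewrite (bern_laplace_fin (_ : 0 < (b + 1) / 2 < 1)).1; last lra.
rewrite -EFinD -EFinM => -[h].
rewrite /D mulrBr -h -csc2_herglotz//; ring.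
Qed.

End bern_laplace_closed_form.

(** * Euler's reflection formula *)

Section reflection_formula.
Context {R : realType}.
Notation mu := (@lebesgue_measure R).

Lemma integral_itv_expRM (u v s : R) : u < v -> s != 0 ->
  (\int[mu]_(b in `[u, v]) (expR (b * s))%:E =
   ((expR (v * s) - expR (u * s)) / s)%:E)%E.
Proof.
move=> uv s0.
have dF b : is_derive b (1:R) (fun b : R => s^-1 * expR (s * b)) (expR (b * s)).
  apply: (is_derive_eq (is_deriveM (is_derive_cst s^-1 b 1) (is_derive_expRM s b))).
  by rewrite scaler0 addr0 /GRing.scale/= mulrA mulVf// mul1r mulrC.
have cF : continuous (fun b : R => s^-1 * expR (s * b)).
  by move=> b; apply: differentiable_continuous; apply/derivable1_diffP; have [] := dF b.
rewrite (@continuous_FTC2 _ _ (fun b => s^-1 * expR (s * b)))//.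
- by rewrite -EFinB; congr EFin; rewrite -mulrBr mulrC !(mulrC s).
- apply: continuous_subspaceT => b; rewrite /continuous_at mulrC.
  by under eq_fun do rewrite mulrC; exact: continuous_expRM.
- split => //.
  + by apply: cvg_at_right_filter; exact: cF.
  + by apply: cvg_at_left_filter; exact: cF.
- by move=> b _; rewrite derive1E derive_val.
Qed.

(** The factor s cancels and (e^(s/2) - 1) / (e^s - 1) = 1 / (e^(s/2) + 1). At s = 0, treated apart,
    both sides are 1/2, the length of the interval. *)
Lemma bernoulli_kernel_integral_expRM (x s : R) :
  ((bernoulli_kernel s)%:E *
     \int[mu]_(b in `[(x / 2)%R, ((x + 1) / 2)%R]) (expR (b * s))%:E =
   (expR (x * (s / 2)) / (1 + expR (s / 2)))%:E)%E.
Proof.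
have xx : x / 2 < (x + 1) / 2 by lra.
have [->|s0] := eqVneq s 0.
  rewrite bernoulli_kernel0 mul1e; under eq_integral do rewrite mulr0 expR0.
  rewrite integral_cst//= lebesgue_measure_itv/= lte_fin xx -EFinD mul1e.
  by congr EFin; rewrite mul0r mulr0 expR0; field.
rewrite integral_itv_expRM// -EFinM; congr EFin.
rewrite /bernoulli_kernel (negbTE s0).
have := expRB1_neq0 s0.
have -> : (x + 1) / 2 * s = x * (s / 2) + s / 2 by field.
have -> : x / 2 * s = x * (s / 2) by field.
have -> : expR s = expR (s / 2) * expR (s / 2) by rewrite -expRD -splitr.
rewrite expRD; have := expR_gt0 (s / 2); set e := expR (s / 2) => e0 e1.
have e2 : 1 + e != 0 by rewrite gt_eqF// addr_gt0.
by field; rewrite e2 s0 e1.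
Qed.

Lemma integral_bernoulli_laplace (x : R) :
  (\int[mu]_(b in `[(x / 2)%R, ((x + 1) / 2)%R]) bern_laplace b =
   \int[mu]_s (expR (x * (s / 2)) / (1 + expR (s / 2)))%:E)%E.
Proof.
set J : set R := `[_, _]%classic.
pose f (z : R * R) : \bar R := (\1_J z.1 * (bernoulli_kernel z.2 * expR (z.1 * z.2)))%:E.
have f0 z : (0 <= f z)%E.
  by rewrite lee_fin mulr_ge0// mulr_ge0 ?expR_ge0// ltW// bernoulli_kernel_gt0.
have mb : measurable_fun setT (@bernoulli_kernel R).
  by apply: continuous_measurable_fun; exact: continuous_bernoulli_kernel.
have mf : measurable_fun setT f.
  apply/measurable_EFinP; apply: measurable_funM.
    apply: (@measurableT_comp _ _ _ _ _ _ (\1_J : R -> R) _ fst) => //.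
    by apply: measurable_indic; exact: measurable_itv.
  apply: measurable_funM; first exact: measurableT_comp.
  by apply: measurableT_comp => //; exact: measurable_funM.
transitivity (\int[mu]_b \int[mu]_s f (b, s))%E.
  rewrite integral_mkcond; apply: eq_integral => b _.
  rewrite /patch /f /=; case: ifPn => bJ.
    by apply: eq_integral => s _; rewrite indicE bJ mul1r.
  by rewrite integral0_eq// => s _; rewrite indicE (negbTE bJ) mul0r.
transitivity (\int[mu]_s \int[mu]_b f (b, s))%E; first exact: fubini_tonelli.
apply: eq_integral => s _.
rewrite -bernoulli_kernel_integral_expRM -ge0_integralZl//.
- rewrite [RHS]integral_mkcond; apply: eq_integral => b _.
  rewrite /patch /f /=; case: ifPn => bJ; first by rewrite indicE bJ mul1r EFinM.
  by rewrite indicE (negbTE bJ) mul0r.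
- apply/measurable_EFinP; apply: measurable_funTS; apply: measurableT_comp => //.
  exact: measurable_funM.
- by rewrite lee_fin ltW// bernoulli_kernel_gt0.
Qed.

Lemma is_derive_cot (b : R) : sin (pi * b) != 0 ->
  is_derive b (1 : R) (fun b => - pi * (cos (pi * b) / sin (pi * b)))
    (pi ^+ 2 / sin (pi * b) ^+ 2).
Proof.
move=> s0.
have dpi : is_derive b (1:R) (fun b : R => pi * b) pi.
  apply: (is_derive_eq (is_deriveM (is_derive_cst pi b 1) (is_derive_id b (1:R)))).
  by rewrite scaler0 addr0 /GRing.scale/= mulr1.
have ds : is_derive b (1:R) (fun b : R => sin (pi * b)) (cos (pi * b) * pi).
  exact: (@is_derive1_comp _ sin (fun b => pi * b) b _ _ _ dpi).
have dc : is_derive b (1:R) (fun b : R => cos (pi * b)) (- sin (pi * b) * pi).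
  exact: (@is_derive1_comp _ cos (fun b => pi * b) b _ _ _ dpi).
have dsV : is_derive b (1:R) (fun b : R => (sin (pi * b))^-1)
    (- (sin (pi * b)) ^- 2 * (cos (pi * b) * pi)).
  apply: DeriveDef; first exact: derivableV.
  by rewrite deriveV// derive_val.
apply: (is_derive_eq (is_deriveM (is_derive_cst (- pi) b 1) (is_deriveM dc dsV))).
rewrite scaler0 addr0 /GRing.scale/=; move: (cos2Dsin2 (pi * b)) s0.
set s := sin _; set c := cos _; move: (pi : R) => p cs s0.
rewrite -[in RHS](mulr1 (p ^+ 2)) -cs.
by field.
Qed.

Lemma integral_logistic_expR (x : R) : 0 < x < 1 ->
  (\int[mu]_r (expR (x * r) / (1 + expR r))%:E = (pi / sin (pi * x))%:E)%E.
Proof.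
move=> x01; have /andP[x0 x1] := x01.
rewrite (@ge0_integralT_affine _ (fun r => expR (x * r) / (1 + expR r)) 2^-1 0)//;
  last first.
- move=> r; apply: cvgM; first exact: continuous_expRM.
  apply: cvgV; first by rewrite gt_eqF// addr_gt0// expR_gt0.
  by apply: cvgD; [exact: cvg_cst|exact: continuous_expR].
have -> : (\int[mu]_r (expR (x * (2^-1 * r + 0)) / (1 + expR (2^-1 * r + 0)))%:E =
   \int[mu]_s (expR (x * (s / 2)) / (1 + expR (s / 2)))%:E)%E.
  by apply: eq_integral => r _; rewrite addr0 (mulrC 2^-1).
rewrite -integral_bernoulli_laplace.
have J01 b : x / 2 <= b <= (x + 1) / 2 -> 0 < b < 1 by move=> /andP[? ?]; lra.
have sn0 b : x / 2 <= b <= (x + 1) / 2 -> sin (pi * b) != 0.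
  by move=> /J01/sin_piM_gt0 h; rewrite gt_eqF.
have -> : (\int[mu]_(b in `[(x / 2)%R, ((x + 1) / 2)%R]) bern_laplace b =
    \int[mu]_(b in `[(x / 2)%R, ((x + 1) / 2)%R])
       (pi ^+ 2 / sin (pi * b) ^+ 2)%:E)%E.
  apply: eq_integral => b; rewrite inE/= in_itv/= => /J01 ?.
  by rewrite bern_laplaceE.
have cF b : x / 2 <= b <= (x + 1) / 2 ->
    {for b, continuous (fun b => - pi * (cos (pi * b) / sin (pi * b)))}.
  move=> /sn0/is_derive_cot[d _].
  by apply: differentiable_continuous; apply/derivable1_diffP.
(* As cot(y + pi/2) = -tan y, the integral is pi (cot y + tan y) = 2 pi / sin(2 y) with y = pi x/2;
   the factor 1/2 from the change of variables removes the 2. *)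
rewrite (@continuous_FTC2 _ _ (fun b => - pi * (cos (pi * b) / sin (pi * b)))).
- rewrite -EFinB -EFinM; congr EFin.
  have := sin_piM_gt0 x01.
  have -> : pi * ((x + 1) / 2) = pi * (x / 2) + pi / 2 :> R by field.
  have -> : pi * x = (pi * (x / 2)) *+ 2 by rewrite mulr2n; field.
  rewrite sinDpihalf cosDpihalf sin_mulr2n; have := cos2Dsin2 (pi * (x / 2)).
  set s := sin _; set c := cos _ => cs sc0.
  have s0 : s != 0 by apply/eqP => s0; move: sc0; rewrite s0 mulr0 mul0rn ltxx.
  have c0 : c != 0 by apply/eqP => c0; move: sc0; rewrite c0 mul0r mul0rn ltxx.
  move: (pi : R) => p.
  have -> : p / (c * s *+ 2) = p * (c ^+ 2 + s ^+ 2) / (c * s *+ 2) by rewrite cs mulr1.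
  by rewrite -mulr_natr; field; rewrite s0 c0.
- lra.
- apply: continuous_in_subspaceT => b; rewrite inE/= in_itv/= => /sn0 s0.
  apply: cvgM; first exact: cvg_cst.
  apply: cvgV; first by rewrite expf_neq0.
  have cs : {for b, continuous (fun b : R => sin (pi * b))}.
    apply: continuous_comp; [exact: mulrl_continuous|exact: continuous_sin].
  by apply: (@continuous_comp _ _ _ (fun b => sin (pi * b)) (fun y => y ^+ 2));
    [exact: cs|exact: exprn_continuous].
- split.
  + move=> b; rewrite in_itv/= => /andP[b1 b2].
    by have [] := @is_derive_cot b (sn0 b ltac:(apply/andP; split; exact: ltW)).
  + by apply: cvg_at_right_filter; apply: cF; lra.
  + by apply: cvg_at_left_filter; apply: cF; lra.
- move=> b; rewrite in_itv/= => /andP[b1 b2].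
  have := @is_derive_cot b (sn0 b ltac:(apply/andP; split; exact: ltW)).
  by move=> d; rewrite derive1E derive_val.
Qed.

(** Euler's integral after s = e^r, left in the extended reals so that divergence is not hidden by a
    default value. *)
Definition GammaE (x : R) : \bar R := (\int[mu]_r (expR (x * r - expR r))%:E)%E.

Lemma GammaE_ge0 x : (0 <= GammaE x)%E.
Proof. by apply: integral_ge0 => r _; rewrite lee_fin expR_ge0. Qed.

Lemma Gamma_integral_expR (x : R) :
  (\int[mu]_(s in `]0%R, +oo[) (s `^ (x - 1) * expR (- s))%:E = GammaE x)%E.
Proof.
rewrite ge0_integral_expR_subst.
- apply: eq_integral => r _; congr EFin.
  rewrite /powR gt_eqF ?expR_gt0// expRK -!expRD; congr expR; ring.
- move=> s; rewrite in_itv/= andbT => s0; apply: cvgM.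
    have : (fun s => expR ((x - 1) * ln s)) @ s --> s `^ (x - 1).
      rewrite /powR gt_eqF//.
      apply: (@continuous_comp _ _ _ (fun s => (x - 1) * ln s) expR);
        last exact: continuous_expR.
      by apply: cvgM; [exact: cvg_cst|exact: continuous_ln].
    apply: cvg_trans; apply: near_eq_cvg; near=> t.
    have t0 : 0 < t by near: t; exact: lt_nbhsr.
    by rewrite /powR gt_eqF.
  apply: (@continuous_comp _ _ _ -%R expR); last exact: continuous_expR.
  exact: oppr_continuous.
- by move=> s s0; rewrite mulr_ge0 ?powR_ge0 ?expR_ge0.
Unshelve. all: by end_near. Qed.

Lemma continuous_expR_affine_expR (c d : R) :
  continuous (fun r => expR (c * r - d * expR r)).
Proof.
move=> r; apply: (@continuous_comp _ _ _ (fun r => c * r - d * expR r) expR);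
  last exact: continuous_expR.
apply: cvgB; first exact: mulrl_continuous.
by apply: cvgM; [exact: cvg_cst|exact: continuous_expR].
Qed.

Lemma GammaE_shift (x d : R) :
  (\int[mu]_r (expR (x * (r + d) - expR (r + d)))%:E = GammaE x)%E.
Proof.
rewrite /GammaE (@ge0_integralT_affine _ (fun r => expR (x * r - expR r)) 1 d)//.
- by rewrite mul1e; apply: eq_integral => r _; rewrite mul1r.
- rewrite (_ : (fun r => _) = (fun r => expR (x * r - 1 * expR r))).
    exact: continuous_expR_affine_expR.
  by apply/funext => r; rewrite mul1r.
Qed.

Lemma integral_expR_expR (c : R) : 0 < c ->
  (\int[mu]_q (expR (q - c * expR q))%:E = c^-1%:E)%E.
Proof.
move=> c0; rewrite -integral0y_expRN// -integral_itv_obnd_cbnd; last first.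
  apply/measurable_EFinP/measurable_funTS; apply: continuous_measurable_fun.
  exact: continuous_expRNM.
rewrite ge0_integral_expR_subst.
- by apply: eq_integral => q _; rewrite -expRD addrC.
- by move=> x _; exact: continuous_expRNM.
- by move=> x _; exact: expR_ge0.
Qed.

(** In the double integral over (q, p) of e^((1 - x) q - e^q) e^(x p - e^p), translating p by q
    gives the exponent x p + q - (1 + e^p) e^q. The integral in q is then 1 / (1 + e^p). *)
Lemma GammaE_mul (x : R) :
  (GammaE x * GammaE (1 - x) = \int[mu]_r (expR (x * r) / (1 + expR r))%:E)%E.
Proof.
pose f (z : R * R) : \bar R :=
  (expR (x * z.2 + z.1 - (1 + expR z.2) * expR z.1))%:E.
have f0 z : (0 <= f z)%E by rewrite lee_fin expR_ge0.
have mf : measurable_fun setT f.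
  apply/measurable_EFinP; apply: measurableT_comp => //.
  apply: measurable_funB.
    by apply: measurable_funD => //; exact: measurable_funM.
  apply: measurable_funM; last exact: measurableT_comp.
  by apply: measurable_funD => //; exact: measurableT_comp.
have mG y : measurable_fun setT (fun r : R => expR (y * r - expR r)).
  apply: continuous_measurable_fun.
  rewrite (_ : (fun r => _) = (fun r => expR (y * r - 1 * expR r))).
    exact: continuous_expR_affine_expR.
  by apply/funext => r; rewrite mul1r.
transitivity (\int[mu]_q \int[mu]_p f (q, p))%E.
  rewrite /GammaE -/(GammaE x) -ge0_integralZl//; last 2 first.
  - by apply/measurable_EFinP; exact: mG.
  - exact: GammaE_ge0.
  apply: eq_integral => q _; rewrite -(GammaE_shift x q) -ge0_integralZr//.
  - apply: eq_integral => p _; rewrite /f /= -EFinM -expRD; congr (expR _)%:E.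
    by rewrite expRD; ring.
  - apply/measurable_EFinP.
    apply: (@measurableT_comp _ _ _ _ _ _ (fun r : R => expR (x * r - expR r))
      _ (fun p : R => p + q)); first exact: mG.
    exact: measurable_funD.
transitivity (\int[mu]_p \int[mu]_q f (q, p))%E; first exact: fubini_tonelli.
apply: eq_integral => p _.
have c0 : 0 < 1 + expR p by rewrite addr_gt0// expR_gt0.
rewrite EFinM -(integral_expR_expR c0) -ge0_integralZl//.
- by apply: eq_integral => q _; rewrite /f /= -EFinM -expRD addrA.
- apply/measurable_EFinP; apply: continuous_measurable_fun.
  rewrite (_ : (fun q => _) = (fun q => expR (1 * q - (1 + expR p) * expR q))).
    exact: continuous_expR_affine_expR.
  by apply/funext => q; rewrite mul1r.
Qed.

(** The product of the extended values is finite and positive. An infinite factor would make it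
    infinite, or zero if the other factor were 0, so both are finite and [Gamma], a [fine] part,
    loses nothing. *)
Theorem Gamma_reflection (x : R) : 0 < x < 1 ->
  [/\ GammaE (1 - x) = (Gamma (1 - x))%:E, Gamma x != 0 &
      Gamma x * Gamma (1 - x) = pi / sin (pi * x)].
Proof.
move=> x01; have := GammaE_mul x; rewrite integral_logistic_expR//.
have E y : Gamma y = fine (GammaE y) by rewrite -Gamma_integral_expR.
have c0 : 0 < pi / sin (pi * x) by rewrite divr_gt0 ?pi_gt0// sin_piM_gt0.
rewrite !E; have := GammaE_ge0 x; have := GammaE_ge0 (1 - x).
case: (GammaE x) => [u| |]//; case: (GammaE (1 - x)) => [v| |]//=.
- rewrite !lee_fin => v0 u0 [uv]; split => //.
  by apply/eqP => uz; move: c0; rewrite -uv uz mul0r ltxx.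
- rewrite lee_fin => _; rewrite le_eqVlt => /predU1P[<-|u0].
    by rewrite mul0e => -[h]; move: c0; rewrite -h ltxx.
  by rewrite gt0_muley.
- rewrite lee_fin; rewrite le_eqVlt => /predU1P[<-|v0].
    by rewrite mule0 => _ -[h]; move: c0; rewrite -h ltxx.
  by rewrite gt0_mulye.
Qed.

End reflection_formula.

(** * Differentiation under the integral sign *)

Section smoothness.
Context {R : realType}.

Lemma smooth_of_stable_family (P : set (R -> R)) :
  (forall g, P g -> exists2 g', P g' & forall x : R, is_derive x (1 : R) g (g' x)) ->
  forall g, P g -> smooth g.
Proof.
move=> PD.
have PD1 g : P g -> [/\ P (derive1 g), forall x, derivable g x 1 & continuous g].
  move=> /PD[g' Pg' dg]; have gE : derive1 g = g'.
    by apply/funext => x; rewrite derive1E derive_val.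
  have dg1 x : derivable g x 1 by have [] := dg x.
  split; [by rewrite gE|by []|move=> x].
  by apply: differentiable_continuous; apply/derivable1_diffP.
move=> g Pg n.
have : P (derive1n n g) by elim: n => [//|n /PD1[]].
by move/PD1 => [].
Qed.

Lemma is_derive_sum_seq (T : Type) (B : T -> R -> R) (B' : T -> R) (l : seq T)
    (x : R) : (forall p, is_derive x (1 : R) (B p) (B' p)) ->
  is_derive x (1 : R) (fun r => \sum_(p <- l) B p r) (\sum_(p <- l) B' p).
Proof.
move=> dB; elim: l => [|p l ih].
  rewrite big_nil (_ : (fun r => _) = cst 0); first exact: is_derive_cst.
  by apply/funext => r; rewrite big_nil.
rewrite big_cons (_ : (fun r => _) = B p + (fun r => \sum_(q <- l) B q r)).
  exact: is_deriveD.
by apply/funext => r; rewrite big_cons.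
Qed.

End smoothness.

(** * Smoothness of the Laplace-type integral of f *)

Section laplace_type_integral.
Context {R : realType}.
Notation mu := (@lebesgue_measure R).
Variables (a t : R) (f : R -> R).
Hypothesis cf : {within `[a, t], continuous f}.

Lemma integrable_continuousM (h : R -> R) : continuous h ->
  mu.-integrable `[a, t] (EFin \o (fun s => h s * f s)).
Proof.
move=> ch; apply: continuous_compact_integrable; first exact: segment_compact.
move=> s; apply: continuousM; last exact: cf.
exact: continuous_subspaceT.
Qed.

(** The [k]-th derivative in [x] of the integral of e^(-(t - s) x) f(s); for [k = 0] and
    [x = expR r] it is the integral in [phi]. *)
Definition laplace_moment (k : nat) (x : R) : R :=
  \int[mu]_(s in `[a, t]) ((- (t - s)) ^+ k * expR (- (t - s) * x) * f s).

Let h (k : nat) (x s : R) := (- (t - s)) ^+ k * expR (- (t - s) * x).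

Let ch k x : continuous (h k x).
Proof.
have c1 : continuous (fun s : R => - (t - s)).
  by move=> s; apply: cvgN; apply: cvgB; [exact: cvg_cst|exact: cvg_id].
move=> s; apply: cvgM.
  by apply: (@continuous_comp _ _ _ (fun s : R => - (t - s)) (fun y => y ^+ k));
    [exact: c1|exact: exprn_continuous].
apply: (@continuous_comp _ _ _ (fun s : R => - (t - s) * x) expR);
  last exact: continuous_expR.
by apply: cvgM; [exact: c1|exact: cvg_cst].
Qed.

Let dh k x s : is_derive x (1:R) (fun x => h k x s * f s) (h k.+1 x s * f s).
Proof.
have := is_deriveM (is_deriveM (is_derive_cst ((- (t - s)) ^+ k) x (1:R))
  (is_derive_expRM (- (t - s)) x)) (is_derive_cst (f s) x (1:R)).
move/is_derive_eq; apply.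
by rewrite /h !scaler0 add0r addr0 /GRing.scale/= exprSr; ring.
Qed.

Lemma is_derive_laplace_moment k (x : R) :
  is_derive x 1 (laplace_moment k) (laplace_moment k.+1 x).
Proof.
pose F y s := h k y s * f s.
have dF y s : partial1of2 F y s = h k.+1 y s * f s.
  by rewrite partial1of2E; have [_ <-] := dh k y s.
have xI : `]x - 1, x + 1[%classic x by rewrite /= in_itv/=; lra.
(* Dominates the differentiated kernel for |y - x| < 1, from 0 <= t - s <= t - a and |y| <= |x| +
   1. *)
pose M := (t - a) ^+ k.+1 * expR ((t - a) * (`|x| + 1)).
pose G s := `|M * f s|.
have iF (y : R) : `]x - 1, x + 1[%classic y -> mu.-integrable `[a, t] (EFin \o F y).
  by move=> _; apply: integrable_continuousM; exact: ch.
have d1 (y s : R) : `]x - 1, x + 1[%classic y -> `[a, t]%classic s ->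
    derivable (F ^~ s) y 1.
  by move=> _ _; have [] := dh k y s.
have G0 s : 0 <= G s by exact: normr_ge0.
have iG : mu.-integrable `[a, t] (EFin \o G).
  apply: (@integrable_norm _ _ _ mu `[a, t] (fun s => M * f s)).
  by apply: integrable_continuousM => s; exact: cvg_cst.
have ub (y s : R) : `]x - 1, x + 1[%classic y -> `[a, t]%classic s ->
    `|partial1of2 F y s| <= G s.
  rewrite /= !in_itv/= => /andP[y1 y2] /andP[s1 s2].
  rewrite dF /G !normrM ler_wpM2r//.
  have ts : 0 <= t - s by rewrite subr_ge0.
  have ta : 0 <= t - a by lra.
  rewrite (ger0_norm (exprn_ge0 _ ta)) (ger0_norm (expR_ge0 _)) (ger0_norm (expR_ge0 _)).
  apply: ler_pM; rewrite ?expR_ge0//.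
    by rewrite normrX normrN (ger0_norm ts) lerXn2r ?nnegrE//; lra.
  rewrite ler_expR mulNr -mulrN (le_trans (ler_norm _))// normrM (ger0_norm ts).
  apply: ler_pM => //; first lra.
  by rewrite normrN ler_norml; have := ler_norm x; have := ler_norm (- x);
    rewrite normrN => ? ?; lra.
split.
- exact: (@derivable_under_integral R _ _ mu F `[a, t]%classic (measurable_itv _)
    x (x - 1) (x + 1) xI iF d1 G G0 iG ub).
- rewrite -derive1E.
  rewrite (@differentiation_under_integral R _ _ mu F `[a, t]%classic (measurable_itv _)
    x (x - 1) (x + 1) xI iF d1 G G0 iG ub).
  by apply: eq_Rintegral => s _; rewrite dF.
Qed.

(** Differentiating c e^(d r) L_k(e^r), with L_k the moment of order k, gives c d e^(d r) L_k(e^r) +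
    c e^((d + 1) r) L_(k+1)(e^r). Finite sums of such terms, encoded by lists of triples (c, d, k),
    are therefore stable under derivation. *)
Lemma smooth_expR_laplace_moment (c d : R) :
  smooth (fun r => c * expR (d * r) * laplace_moment 0 (expR r)).
Proof.
pose B (p : R * R * nat) (r : R) :=
  p.1.1 * expR (p.1.2 * r) * laplace_moment p.2 (expR r).
have dB p r : is_derive r (1:R) (B p)
    (B (p.1.1 * p.1.2, p.1.2, p.2) r + B (p.1.1, p.1.2 + 1, p.2.+1) r).
  have dl : is_derive r (1:R) (fun r => laplace_moment p.2 (expR r))
      (laplace_moment p.2.+1 (expR r) * expR r).
    exact: (@is_derive1_comp _ (laplace_moment p.2) expR r _ _
      (is_derive_laplace_moment _ _) (is_derive_expR r)).
  have := is_deriveM (is_deriveM (is_derive_cst p.1.1 r (1:R))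
    (is_derive_expRM p.1.2 r)) dl.
  move/is_derive_eq; apply.
  rewrite /B/= scaler0 addr0 /GRing.scale/= mulrDl expRD mul1r !fctE; ring.
have -> : (fun r => c * expR (d * r) * laplace_moment 0 (expR r)) = B (c, d, 0%N).
  by [].
move: B dB => B dB; pose P : set (R -> R) :=
  [set g | exists l : seq (R * R * nat), g = fun r => \sum_(p <- l) B p r].
apply: (@smooth_of_stable_family R P); last first.
  by exists [:: (c, d, 0%N)]; apply/funext => r; rewrite big_seq1.
move=> g [l ->].
exists (fun r => \sum_(p <- flatten [seq [:: (p.1.1 * p.1.2, p.1.2, p.2);
    (p.1.1, p.1.2 + 1, p.2.+1)] | p <- l]) B p r); first by eexists.
move=> r; apply: (is_derive_eq (is_derive_sum_seq l (dB ^~ r))).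
elim: l => [|p l ih]; first by rewrite !big_nil.
by rewrite [flatten _]/= !big_cons ih addrA.
Qed.

End laplace_type_integral.

(** * The initial value problem *)

Section derivative_within.
Context {R : realType}.
Implicit Types (A : set R) (y z : R -> R).

Lemma is_derive_is_derive_within A y z (x d : R) : A x ->
  {in A, y =1 z} -> is_derive x (1 : R) z d -> is_derive_within A y x d.
Proof.
move=> Ax yz [dz dE].
have : (fun h => h^-1 *: ((z \o shift x) (h *: (1 : R)) - z x)) @ 0^' --> d.
  by rewrite -dE; exact: dz.
move=> /cvgrPdist_lt H; apply/cvgrPdist_lt => e e0.
have [r r0 {}H] := H e e0.
exists r => //= s sx sneq As.
have := H (s - x).
rewrite /ball_/= sub0r normrN distrC in sx *.
move=> /(_ sx); rewrite subr_eq0 => /(_ sneq).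
rewrite /GRing.scale/= mulr1 subrK => h.
by rewrite !yz ?inE// mulrC.
Qed.

Lemma is_derive_within_is_derive A y (x d : R) : nbhs x A ->
  is_derive_within A y x d -> is_derive x (1 : R) y d.
Proof.
move=> nA /cvgrPdist_lt H.
suff h : (fun h => h^-1 *: ((y \o shift x) (h *: (1 : R)) - y x)) @ 0^' --> d.
  by apply: DeriveDef; [apply/cvg_ex; exists d|exact: cvg_lim].
apply/cvgrPdist_lt => e e0.
have [r r0 {}H] := H e e0; have [r' r'0 A'] := nA.
exists (Num.min r r'); first by rewrite /= lt_min r0.
move=> h /=; rewrite sub0r normrN lt_min => /andP[hr hr'] h0.
have := H (h + x); rewrite /= addrK opprD addrCA subrr addr0 normrN => /(_ hr).
rewrite -subr_eq0 addrK => /(_ h0).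
rewrite /GRing.scale/= mulr1 mulrC; apply.
by apply: A'; rewrite /= opprD addrCA subrr addr0 normrN.
Qed.

Lemma is_derive_within_cvg A y (x d : R) :
  is_derive_within A y x d -> y s @[s --> within A (nbhs x)] --> y x.
Proof.
move=> /cvgrPdist_lt /(_ 1 ltr01)[r r0 H]; apply/cvgrPdist_lt => e e0.
have d0 : 0 < `|d| + 1 by rewrite ltr_wpDl.
exists (Num.min r (e / (`|d| + 1))); first by rewrite /= lt_min r0 divr_gt0.
move=> s /=; rewrite lt_min => /andP[sr se] As.
have [->|sx] := eqVneq s x; first by rewrite subrr normr0.
have sx0 : s - x != 0 by rewrite subr_eq0.
have := H s sr sx As; set q := _ / _ => hq.
have -> : y x - y s = - (q * (s - x)) by rewrite /q divfK// opprB.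
rewrite normrN normrM distrC.
have q1 : `|q| <= `|d| + 1.
  rewrite -(subrK d q) (le_trans (ler_normD _ _))// addrC lerD2l distrC ltW//.
apply: (@le_lt_trans _ _ ((`|d| + 1) * `|x - s|)); first by rewrite ler_wpM2r.
by rewrite mulrC -ltr_pdivlMr.
Qed.

End derivative_within.

Section relaxation_ivp.
Context {R : realType}.
Notation mu := (@lebesgue_measure R).
Variables (a b : R) (f : R -> R).
Hypothesis ab : a < b.
Hypothesis cf : {within `[a, b], continuous f}.

Let clamp (x : R) := Num.max a (Num.min x b).

Let clampE x : x \in `[a, b] -> clamp x = x.
Proof.
by rewrite in_itv/= => /andP[ax xb]; rewrite /clamp (min_idPl xb) (max_idPr ax).
Qed.

Let clamp_itv x : `[a, b]%classic (clamp x).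
Proof. by rewrite /= in_itv/= /clamp le_max lexx/= ge_max ge_min lexx orbT (ltW ab). Qed.

Let continuous_f_clamp : continuous (f \o clamp).
Proof.
have cc : continuous clamp.
  move=> x; apply: (@continuous_max _ _ (cst a) (id \min cst b)).
    exact: cvg_cst.
  by apply: (@continuous_min _ _ id (cst b)); [exact: cvg_id|exact: cvg_cst].
move=> x; have /subspace_continuousP h := cf.
apply: cvg_comp (h _ (clamp_itv x)) => P hP.
have hP' : nbhs x [set z | `[a, b]%classic (clamp z) -> P (clamp z)] := cc x _ hP.
suff : nbhs x (clamp @^-1` P) by [].
by apply: filterS hP' => z /(_ (clamp_itv z)).
Qed.

Variables (E K : R).

(** Variation of constants for y' = -E y + K f. For [E = expR r] and
    [K = c_ alpha * expR ((1 - alpha) * r)] it is [phi]. *)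
Definition relaxation (t : R) : R :=
  K * \int[mu]_(s in `[a, t]) (expR (- (t - s) * E) * f s).

(* Extending f by constants outside [a, b] and integrating from a - 1 turns the
   one-sided derivatives at a and b into two-sided ones. *)
Lemma relaxation_extension : exists2 Y : R -> R,
  {in `[a, b], relaxation =1 Y} &
  {in `[a, b], forall t, is_derive t (1 : R) Y (- E * Y t + K * f t)}.
Proof.
(* Pulling e^(-E t) out of the integral leaves an integrand free of t, to which the fundamental
   theorem applies. *)
pose g s := expR (E * s) * (f \o clamp) s.
have cg : continuous g.
  by move=> s; apply: cvgM; [exact: continuous_expRM|exact: continuous_f_clamp].
have ig (u v : R) : mu.-integrable `[u, v] (EFin \o g).
  apply: continuous_compact_integrable; first exact: segment_compact.
  exact: continuous_subspaceT.
pose Phi t := \int[mu]_(s in `[a - 1, t]) g s - \int[mu]_(s in `[a - 1, a]) g s.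
exists (fun t => K * (expR (- E * t) * Phi t)).
  move=> t; rewrite in_itv/= => /andP[at_ tb]; rewrite /relaxation; congr (_ * _).
  rewrite /Phi (@Rintegral_itvB _ g (BLeft (a - 1)) (BRight t) a) ?bnd_simp//; last first.
    by rewrite gerBl.
  rewrite Rintegral_itv_obnd_cbnd; last first.
    apply: integrableS (ig a t) => //; exact: subset_itv_oc_cc.
  rewrite -RintegralZl//.
  apply: eq_Rintegral => s; rewrite inE/= in_itv/= => /andP[as_ st].
  rewrite /g /= clampE ?in_itv/= ?as_ ?(le_trans st)// mulrA -expRD.
  by congr (expR _ * _); ring.
move=> t tab; have /andP[at_ tb] : a <= t <= b by rewrite in_itv in tab.
have dPhi : is_derive t (1 : R) Phi (g t).
  have [d dE] := @continuous_FTC1_closed R g (a - 1) t (t + 1)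
    ltac:(by rewrite ltrDl) (ig _ _) ltac:(by rewrite ltrBlDr ltr_pwDr) (cg t).
  rewrite /Phi -[g t]subr0; apply: (is_deriveB _ (is_derive_cst _ t (1:R))).
  by apply: DeriveDef => //; rewrite -derive1E dE.
have := is_deriveM (is_derive_cst K t (1:R)) (is_deriveM (is_derive_expRM (- E) t) dPhi).
move/is_derive_eq; apply.
rewrite scaler0 addr0 /GRing.scale/= /g/= clampE//.
have : expR (- E * t) * expR (E * t) = 1 by rewrite -expRD mulNr addNr expR0.
set u := expR (- E * t); set v := expR (E * t) => uv.
rewrite [u * (v * _)]mulrA uv mul1r.
by ring.
Qed.

Lemma relaxation_solves :
  solves_ivp a b (fun t x => - E * x + K * f t) 0 relaxation.
Proof.
have [Y rY dY] := relaxation_extension.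
split.
  move=> t tab; apply: (@is_derive_is_derive_within _ _ _ Y) => //.
  - by move=> s; rewrite inE/=; exact: rY.
  - by rewrite (rY t)//; exact: dY.
by rewrite /relaxation set_itv1 Rintegral_set1 mulr0.
Qed.

Lemma relaxation_unique (y : R -> R) :
  solves_ivp a b (fun t x => - E * x + K * f t) 0 y ->
  {in `[a, b], y =1 relaxation}.
Proof.
move=> [dy y0] t tab; have [dr r0] := relaxation_solves.
have /andP[at0 tb] : a <= t <= b by rewrite in_itv in tab.
move: at0; rewrite le_eqVlt => /predU1P[<-|at_]; first by rewrite y0 r0.
(* Integrating factor: the forcing terms cancel in the difference of two solutions, so [w] has
   derivative 0 inside and starts at 0. *)
pose w s := expR (E * s) * (y s - relaxation s).
have dw s : s \in `]a, t[ -> is_derive s (1 : R) w 0.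
  rewrite in_itv/= => /andP[as_ st].
  have sab : s \in `[a, b] by rewrite in_itv/=; lra.
  have nb : nbhs s `[a, b]%classic.
    by apply: (@filterS _ _ _ `]a, b[%classic); [exact: subset_itv_oo_cc|
      apply: near_in_itvoo; rewrite in_itv/= as_/= (lt_le_trans st)].
  have := is_deriveM (is_derive_expRM E s) (is_deriveB
    (is_derive_within_is_derive nb (dy s sab))
    (is_derive_within_is_derive nb (dr s sab))).
  by move/is_derive_eq; apply; rewrite /GRing.scale/= !fctE; ring.
have cw : {within `[a, t], continuous w}.
  apply/subspace_continuousP => s sat.
  have sab : s \in `[a, b] by move: sat; rewrite /= !in_itv/=; lra.
  have sub : (`[a, t]%classic : set R) `<=` `[a, b]%classic.
    by apply: subset_itvl; rewrite bnd_simp.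
  have wi z d : is_derive_within `[a, b]%classic z s d ->
      z u @[u --> within `[a, t]%classic (nbhs s)] --> z s.
    move=> /is_derive_within_cvg zs P /zs hP.
    have {}hP : nbhs s [set u | `[a, b]%classic u -> P (z u)] := hP.
    suff : nbhs s [set u | `[a, t]%classic u -> P (z u)] by [].
    by apply: filterS hP => u hu /sub.
  apply: cvgM.
    by apply: cvg_within_filter; exact: continuous_expRM.
  by apply: cvgB; [exact: wi (dy s sab)|exact: wi (dr s sab)].
have [c _] := MVT at_ dw cw.
rewrite mul0r /w y0 r0 subrr mulr0 subr0 => /eqP.
by rewrite mulf_eq0 gt_eqF ?expR_gt0//= subr_eq0 => /eqP.
Qed.

End relaxation_ivp.

(** * Integration over the modes *)

Section diffusive_representation.
Context {R : realType}.
Notation mu := (@lebesgue_measure R).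

(** With E = e^r, the first bound is the useful one as r tends to +oo and the second as r tends to
    -oo. *)
Lemma integral_itv_expR_le (a t E : R) : a <= t -> 0 < E ->
  \int[mu]_(s in `[a, t]) expR (- (t - s) * E) <= E^-1 /\
  \int[mu]_(s in `[a, t]) expR (- (t - s) * E) <= t - a.
Proof.
rewrite le_eqVlt => /predU1P[<- E0|at_ E0].
  by rewrite set_itv1 Rintegral_set1 subrr invr_ge0 ltW.
have En : E != 0 by rewrite gt_eqF.
have -> : \int[mu]_(s in `[a, t]) expR (- (t - s) * E) = (1 - expR (- (t - a) * E)) / E.
  rewrite /Rintegral (_ : (1 - _) / E =
    expR (- (t * E)) * ((expR (t * E) - expR (a * E)) / E)); last first.
    by rewrite mulrA mulrBr -!expRD addNr expR0; congr ((1 - expR _) / _); ring.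
  under eq_integral => s _.
    rewrite (_ : - (t - s) * E = - (t * E) + s * E); last by ring.
    rewrite expRD EFinM; over.
  rewrite ge0_integralZl//.
  - by rewrite integral_itv_expRM.
  - apply/measurable_EFinP/measurable_funTS; apply: measurableT_comp => //.
    exact: measurable_funM.
split; first by rewrite ler_pdivrMr// mulVf// gerBl expR_ge0.
rewrite ler_pdivrMr//; have := expR_ge1Dx (- (t - a) * E); lra.
Qed.

Section fixed_time.
Variables (a t : R).
Hypothesis at_ : a <= t.

(** [phi] without the constant [c_ alpha]; [f] is an argument because the estimates are also applied
    to |f|. *)
Definition relaxation_mode (x : R) (f : R -> R) (r : R) : R :=
  expR (x * r) * \int[mu]_(s in `[a, t]) (expR (- (t - s) * expR r) * f s).

Let continuous_kernel (E : R) : continuous (fun s : R => expR (- (t - s) * E)).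
Proof.
move=> s; apply: (@continuous_comp _ _ _ (fun s : R => - (t - s) * E) expR);
  last exact: continuous_expR.
apply: cvgM; last exact: cvg_cst.
by apply: cvgN; apply: cvgB; [exact: cvg_cst|exact: cvg_id].
Qed.

Lemma integrable_kernel (E : R) (f : R -> R) : {within `[a, t], continuous f} ->
  mu.-integrable `[a, t] (EFin \o (fun s => expR (- (t - s) * E) * f s)).
Proof. by move=> cf; apply: integrable_continuousM. Qed.

Lemma relaxation_mode_bound (x : R) (f : R -> R) :
  {within `[a, t], continuous f} ->
  exists2 C, 0 <= C & forall r,
    `|relaxation_mode x f r| <= C * expR (x * r) /\
    `|relaxation_mode x f r| <= C * expR ((x - 1) * r).
Proof.
move=> cf.
have /compact_bounded[M0 [_ HM]] := continuous_compact cf (@segment_compact _ a t).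
pose M := `|M0| + 1.
have fM s : `[a, t]%classic s -> `|f s| <= M.
  move=> ats; apply: HM; last by exists s.
  by rewrite (le_lt_trans (ler_norm M0))// ltrDl.
have M0' : 0 <= M by rewrite addr_ge0.
(* One constant for both estimates: t - a serves the bound by the length, and 1 the bound by 1/E. *)
exists (M * (t - a + 1)); first by rewrite mulr_ge0// addr_ge0// subr_ge0.
move=> r; have Er := expR_gt0 r; set E := expR r in Er *.
have [b1 b2] := integral_itv_expR_le at_ Er.
have ik : mu.-integrable `[a, t] (EFin \o (fun s => expR (- (t - s) * E))).
  apply: continuous_compact_integrable; first exact: segment_compact.
  exact: continuous_subspaceT.
have bd : `|\int[mu]_(s in `[a, t]) (expR (- (t - s) * E) * f s)| <=
    M * \int[mu]_(s in `[a, t]) expR (- (t - s) * E).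
  apply: (le_trans (le_normr_Rintegral _ (integrable_kernel E cf))) => //.
  rewrite -RintegralZl//; apply: le_Rintegral => //.
  - exact: integrable_norm (integrable_kernel E cf).
  - exact: integrableZl ik.
  - move=> s ats; rewrite normrM (ger0_norm (expR_ge0 _)) mulrC.
    by rewrite ler_wpM2r ?expR_ge0// fM.
have J0 : 0 <= \int[mu]_(s in `[a, t]) expR (- (t - s) * E).
  by apply: Rintegral_ge0 => s _; exact: expR_ge0.
have ta : 0 <= t - a by rewrite subr_ge0.
rewrite /relaxation_mode -/E normrM (ger0_norm (expR_ge0 _)).
have ex0 := expR_ge0 (x * r).
split.
- rewrite mulrC ler_wpM2r// (le_trans bd)// ler_wpM2l//.
  by rewrite (le_trans b2)// lerDl.
- rewrite mulrBl mul1r expRD expRN -/E mulrCA ler_wpM2l//.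
  rewrite (le_trans bd)// -mulrA ler_wpM2l// (le_trans b1)//.
  by rewrite ler_peMl ?invr_ge0 ?(ltW Er)// lerDr.
Qed.

Lemma continuous_relaxation_mode (x : R) (f : R -> R) :
  {within `[a, t], continuous f} -> continuous (relaxation_mode x f).
Proof.
move=> cf; have [_] := smooth_expR_laplace_moment cf 1 x 0.
rewrite derive1n0 (_ : (fun r => _) = relaxation_mode x f)//.
apply/funext => r.
rewrite mul1r /relaxation_mode; congr (_ * _).
by apply: eq_Rintegral => s _; rewrite expr0 mul1r.
Qed.

End fixed_time.

(** Each of the two exponential bounds is integrable on one half-line only, and is used there. *)
Lemma integral_exponential_tails_lty (g : R -> R) (C p q : R) :
  measurable_fun setT g -> 0 < p -> 0 < q ->
  (forall r, 0 <= g r) ->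
  (forall r, g r <= C * expR (q * r)) -> (forall r, g r <= C * expR (- p * r)) ->
  (\int[mu]_r (g r)%:E < +oo)%E.
Proof.
move=> mg p0 q0 g0 gq gp.
have C0 : 0 <= C by have := le_trans (g0 0) (gq 0); rewrite mulr0 expR0 mulr1.
have H c (h : R -> R) : 0 < c -> measurable_fun setT h -> (forall r, 0 <= h r) ->
    (forall r, h r <= C * expR (- (c * r))) ->
    (\int[mu]_(r in `[0%R, +oo[) (h r)%:E < +oo)%E.
  move=> c0 mh h0 hc.
  have mE : measurable_fun setT (fun r => expR (- (c * r))).
    by apply: continuous_measurable_fun; exact: continuous_expRNM.
  apply: (@le_lt_trans _ _
    (\int[mu]_(r in `[0%R, +oo[) (C%:E * (expR (- (c * r)))%:E))%E).
    apply: ge0_le_integral => //.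
    - by move=> r _; rewrite lee_fin.
    - exact/measurable_EFinP/measurable_funTS.
    - by apply: measurable_funeM; exact/measurable_EFinP/measurable_funTS.
    - by move=> r _; rewrite -EFinM lee_fin.
  rewrite ge0_integralZl//; first by rewrite integral0y_expRN// -EFinM ltry.
  exact/measurable_EFinP/measurable_funTS.
rewrite ge0_integralT_halves// lte_add_pinfty//.
- by apply: (H p) => // r; rewrite -mulNr.
- apply: (H q) => //; first exact: measurableT_comp.
  by move=> r; rewrite -mulrN.
Qed.

Lemma integral_expR_kernel (x d : R) : 0 < d ->
  (\int[mu]_r (expR (x * r - d * expR r))%:E = (d `^ (- x))%:E * GammaE x)%E.
Proof.
move=> d0; rewrite -(GammaE_shift x (ln d)) -ge0_integralZl//.
- apply: eq_integral => r _; rewrite -EFinM /powR gt_eqF// -expRD; congr (expR _)%:E.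
  by rewrite expRD lnK ?posrE//; ring.
- apply/measurable_EFinP; apply: measurableT_comp => //.
  apply: measurable_funB; first by apply: measurable_funM => //; exact: measurable_funD.
  by apply: measurableT_comp => //; exact: measurable_funD.
- by rewrite lee_fin powR_ge0.
Qed.

Section integral_over_modes.
Variables (a t alpha : R) (f : R -> R).
Hypothesis at_ : a <= t.
Hypothesis cf : {within `[a, t], continuous f}.
Hypothesis alpha01 : 0 < alpha < 1.

Let psi := relaxation_mode a t (1 - alpha) f.

Let mf : measurable_fun `[a, t] f.
Proof. by apply: subspace_continuous_measurable_fun. Qed.

(* The endpoint s = t is left out: the integral over r diverges there. *)
Let h := f \_ `[a, t[.

Let mh : measurable_fun setT h.
Proof.
have [H _] := measurable_restrictT f (measurable_itv `[a, t[%R).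
apply: H; apply: measurable_funS mf => //.
exact: subset_itv_co_cc.
Qed.

Let Phi (z : R * R) : R := expR ((1 - alpha) * z.2 - (t - z.1) * expR z.2) * h z.1.

Let mPhi : measurable_fun setT Phi.
Proof.
apply: measurable_funM; last first.
  exact: (measurableT_comp mh measurable_fst).
apply: measurableT_comp => //; apply: measurable_funB; first exact: measurable_funM.
apply: measurable_funM; last exact: measurableT_comp.
exact: measurable_funB.
Qed.

(** Stated for a general [g] so as to serve [f] in the exchange of integrals and |f| in the proof of
    integrability. *)
Let integral_Phi_of (g : R -> R) r : {within `[a, t], continuous g} ->
  (\int[mu]_s (expR ((1 - alpha) * r - (t - s) * expR r) * (g \_ `[a, t[) s)%:E =
   (relaxation_mode a t (1 - alpha) g r)%:E)%E.
Proof.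
move=> cg; have ik := integrable_kernel (expR r) cg.
rewrite /relaxation_mode EFinM /Rintegral fineK; last exact: integrable_fin_num ik.
rewrite -integralZl//.
rewrite -integral_itv_bndo_bndc; last first.
  apply: measurable_funeM; apply: measurable_funS (measurable_int _ ik) => //.
  exact: subset_itv_co_cc.
rewrite [RHS]integral_mkcond; apply: eq_integral => s _.
rewrite !patchE; case: ifPn => _; last by rewrite mulr0.
by rewrite -EFinM mulrA -expRD mulNr.
Qed.

(** Integrating |Phi| in s gives the mode of |f|, bounded by multiples of e^((1 - alpha) r) and of
    e^(-alpha r); both exponents have the right sign because 0 < alpha < 1. *)
Let integrable_Phi : (mu \x mu)%E.-integrable setT (EFin \o Phi).
Proof.
apply/integrable21ltyP; first by apply/measurable_EFinP; exact: mPhi.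
have cnf : {within `[a, t], continuous (fun s => `|f s|)}.
  apply/subspace_continuousP => s ats; apply: cvg_norm.
  by move/subspace_continuousP : cf; exact.
have E r : (\int[mu]_s `|(EFin \o Phi) (s, r)| =
    (relaxation_mode a t (1 - alpha) (fun s => `|f s|) r)%:E)%E.
  rewrite -integral_Phi_of//; apply: eq_integral => s _ /=.
  congr EFin; rewrite normrM (ger0_norm (expR_ge0 _)) /h !patchE.
  by case: ifPn => // _; rewrite normr0.
under eq_integral do rewrite E.
have [C C0 Cb] := relaxation_mode_bound at_ (1 - alpha) cnf.
have r0 r : 0 <= relaxation_mode a t (1 - alpha) (fun s => `|f s|) r.
  rewrite mulr_ge0 ?expR_ge0//; apply: Rintegral_ge0 => s _.
  by rewrite mulr_ge0 ?expR_ge0.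
have /andP[al0 al1] := alpha01.
apply: (@integral_exponential_tails_lty _ C alpha (1 - alpha)) => //.
- by apply: continuous_measurable_fun; exact: continuous_relaxation_mode.
- by rewrite subr_gt0.
- by move=> r; have [+ _] := Cb r; rewrite (ger0_norm (r0 r)).
- move=> r; have [_] := Cb r; rewrite (ger0_norm (r0 r)).
  by rewrite (_ : 1 - alpha - 1 = - alpha); last by ring.
Qed.

Lemma integrable_relaxation_mode : mu.-integrable setT (EFin \o psi).
Proof.
have /andP[al0 al1] := alpha01.
have mpsi : measurable_fun setT psi.
  by apply: continuous_measurable_fun; exact: continuous_relaxation_mode.
have [C _ Cb] := relaxation_mode_bound at_ (1 - alpha) cf.
apply/integrableP; split; first exact/measurable_EFinP.
apply: (@integral_exponential_tails_lty (fun r => `|psi r|) C alpha (1 - alpha)) => //.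
- exact: measurableT_comp.
- by rewrite subr_gt0.
- by move=> r; have [] := Cb r.
- move=> r; have [_] := Cb r.
  by rewrite (_ : 1 - alpha - 1 = - alpha); last by ring.
Qed.

Lemma integral_relaxation_mode :
  \int[mu]_r psi r = Gamma (1 - alpha) *
    \int[mu]_(s in `[a, t]) ((t - s) `^ (alpha - 1) * f s).
Proof.
have /andP[al0 al1] := alpha01.
have [GE Gn _] := @Gamma_reflection R alpha alpha01.
have [_ Gn' _] := @Gamma_reflection R (1 - alpha) ltac:(lra).
pose w s := (t - s) `^ (alpha - 1) * f s.
have F s : (\int[mu]_r (EFin \o Phi) (s, r) =
    (Gamma (1 - alpha))%:E * (EFin \o w \_ `[a, t[) s)%E.
  rewrite /Phi /h /= !patchE; case: ifPn => [|_]; last first.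
    by rewrite mule0 integral0_eq// => r _; rewrite mulr0.
  rewrite inE/= in_itv/= => /andP[_ st].
  have d0 : 0 < t - s by rewrite subr_gt0.
  under eq_integral do rewrite mulrC EFinM.
  rewrite integralZl//; last first.
    apply/integrableP; split.
      apply/measurable_EFinP; apply: continuous_measurable_fun.
      exact: continuous_expR_affine_expR.
    under eq_integral do rewrite gee0_abs ?lee_fin ?expR_ge0//.
    by rewrite integral_expR_kernel// GE -EFinM ltry.
  rewrite integral_expR_kernel// GE -!EFinM; congr EFin.
  by rewrite opprB /w; ring.
have iF := integrable_fubini_F integrable_Phi.
(* Integrability of the singular Riemann-Liouville integrand is inherited from Fubini: the marginal
   of [Phi] in s is [Gamma (1 - alpha)] times it, and this factor is nonzero. *)
have iw : mu.-integrable `[a, t[ (EFin \o w).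
  apply/integrable_mkcond => //.
  have := integrableZl measurableT (Gamma (1 - alpha))^-1 iF.
  apply: eq_integrable => // s _.
  rewrite /fubini_F F muleA -[X in (X * _)%E]EFinM mulVf//.
  transitivity ((EFin \o w \_ `[a, t[) s); first exact: mul1e.
  by rewrite /= !patchE; case: ifPn.
rewrite -/(w _) -Rintegral_itv_bndo_bndc// -RintegralZl//.
rewrite /Rintegral; congr fine.
transitivity (\int[mu]_r \int[mu]_s (EFin \o Phi) (s, r))%E.
  by apply: eq_integral => r _; rewrite -integral_Phi_of.
rewrite -(Fubini integrable_Phi) [RHS]integral_mkcond; apply: eq_integral => s _.
rewrite F /= !patchE; case: ifPn => _ /=; first by rewrite -EFinM.
by rewrite mule0.
Qed.

End integral_over_modes.

End diffusive_representation.

(** Integrability in the second item guarantees that the integral over r converges absolutely, so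
    that the equality does not concern a default value. *)
Theorem theorem2 (R : realType) (a b : R) (f : R -> R) (alpha : R)
    (hab : a < b) (hf : {within `[a, b], continuous f})
    (halpha0 : 0 < alpha) (halpha1 : alpha < 1) :
  [/\ forall r : R,
        let F := fun t x : R =>
          - expR r * x + c_ alpha * expR ((1 - alpha) * r) * f t in
        solves_ivp a b F 0 (fun t => phi a alpha f t r) /\
        (forall y : R -> R, solves_ivp a b F 0 y ->
           forall t : R, t \in `[a, b] -> y t = phi a alpha f t r),
      forall t : R, t \in `[a, b] ->
        (@lebesgue_measure R).-integrable setT
          (fun r => (phi a alpha f t r)%:E) /\
        RLint a alpha f t = \int[@lebesgue_measure R]_r phi a alpha f t r,
      forall t : R, t \in `[a, b] -> smooth (phi a alpha f t)
    & forall t : R, t \in `[a, b] ->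
        exists C : R,
          (\forall r \near +oo, `|phi a alpha f t r| <= C * expR (- alpha * r)) /\
          (\forall r \near -oo,
             `|phi a alpha f t r| <= C * expR ((1 - alpha) * r))].
Proof.
have al01 : 0 < alpha < 1 by rewrite halpha0.
have cft t : t \in `[a, b] -> {within `[a, t], continuous f}.
  rewrite in_itv/= => /andP[_ tb]; apply: continuous_subspaceW hf.
  by apply: subset_itvl; rewrite bnd_simp.
have phiE t : phi a alpha f t =
    fun r => c_ alpha * relaxation_mode a t (1 - alpha) f r.
  by apply/funext => r; rewrite /phi /relaxation_mode mulrA.
split.
- move=> r; split.
    exact: (relaxation_solves hab hf (expR r) (c_ alpha * expR ((1 - alpha) * r))).
  by move=> y hy t tab; exact: (relaxation_unique hab hf hy).
- move=> t tab; have at_ : a <= t by move: tab; rewrite in_itv/= => /andP[].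
  have ipsi := integrable_relaxation_mode at_ (cft t tab) al01.
  rewrite phiE; split.
    by under eq_fun do rewrite EFinM; exact: integrableZl.
  rewrite RintegralZl// integral_relaxation_mode//; last exact: cft.
  have [_ Gn GG] := Gamma_reflection al01.
  have pn : (pi : R) != 0 by rewrite gt_eqF// pi_gt0.
  have sn : sin (pi * alpha) != 0 by rewrite gt_eqF// sin_piM_gt0.
  (* What remains is c_alpha Gamma(1 - alpha) = 1 / Gamma(alpha), the reflection formula. *)
  rewrite /RLint mulrA; congr (_ * _); apply: (mulfI Gn); rewrite mulfV//.
  by rewrite mulrCA GG /c_ mulrA divfK// mulfV.
- move=> t tab; rewrite (_ : phi _ _ _ _ = fun r =>
    c_ alpha * expR ((1 - alpha) * r) * laplace_moment a t f 0 (expR r)).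
    exact: smooth_expR_laplace_moment (cft t tab) _ _.
  apply/funext => r; rewrite /phi; congr (_ * _).
  by apply: eq_Rintegral => s _; rewrite expr0 mul1r.
- move=> t tab; have at_ : a <= t by move: tab; rewrite in_itv/= => /andP[].
  have [C _ Cb] := relaxation_mode_bound at_ (1 - alpha) (cft t tab).
  exists (`|c_ alpha| * C); rewrite phiE.
  (* Both estimates hold for every r, hence near either infinity. *)
  split; apply: nearW => r; rewrite normrM -mulrA ler_wpM2l//.
    have [_] := Cb r; by rewrite (_ : 1 - alpha - 1 = - alpha); last by ring.
  by have [] := Cb r.
Qed.
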